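(* There is an absolute constant $K>0$ (independent of $k$ and $n$) such that the following holds. Let $k\ge 1$, let $\pi$ be any permutation of $\{1,\dots,k\}$, let $P_\pi$ be its $k\times k$ permutation matrix, and let $Q=P_\pi\otimes H$ (a $2k\times 3k$ matrix). Then for all $n\ge 1$, \[ \operatorname{Ex}(Q,n)\le n\cdot\left(2^{Kk^2}+(K\alpha(n))^{3k-2}\right)2^{\alpha(n)} . \] In particular, $\operatorname{Ex}(Q,n)= n\cdot 2^{O(k^2)+(1+o(1))\alpha(n)}$.
   Context: All matrices are 0--1 matrices. For a $k\times l$ matrix $P$ and an $n\times m$ matrix $A$, $P$ is contained in $A$ if there are rows $r_1<\dots<r_k$ and columns $c_1<\dots<c_l$ of $A$ with $P(i,j)=1\Rightarrow A(r_i,c_j)=1$; otherwise $A$ avoids $P$. $\operatorname{Ex}(P,n,m)$ is the maximum number of 1s in an $n\times m$ 0--1 matrix avoiding $P$, and $\operatorname{Ex}(P,n)=\operatorname{Ex}(P,n,n)$. The hat pattern is the $2\times 3$ matrix $H$ whose top row is $(0,1,0)$ and bottom row is $(1,0,1)$. For a $k\times l$ 0--1 matrix $P$, $P\otimes H$ is the $2k\times 3l$ matrix partitioned into $2\times 3$ blocks, block $(i,j)$ being $H$ if $P(i,j)=1$ and all-zero otherwise. Ackermann function: $a_{1,j}=2^j$ for $j\ge1$; $a_{i,1}=2$ for $i\ge 2$; $a_{i,j}=w\cdot a_{i-1,w}$ with $w=a_{i,j-1}$ for $i,j\ge2$. For $n,m\ge1$, $\alpha(n,m)=\min\{i\ge1: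 a_{i,j}\ge m\}$ where $j=\max\{3,\lceil n/m\rceil\}$, and $\alpha(n)=\alpha(n,n)$. *)

(* Defs.v *)
From HB Require Import structures.
From mathcomp Require Import all_boot all_order all_algebra all_fingroup.
From mathcomp Require Import mxtens.

Set Implicit Arguments.
Unset Strict Implicit.
Unset Printing Implicit Defensive.

Import GRing.Theory.

(* A 0-1 matrix is a matrix over bool.  MathComp makes bool the two-element
   field, with 0 = false, 1 = true and multiplication &&; perm_mx and the
   Kronecker product *t below are taken over this field. *)

Definition increasing (k n : nat) (f : {ffun 'I_k -> 'I_n}) : bool :=
  [forall i : 'I_k, forall j : 'I_k, (i < j) ==> (f i < f j)].

Definition contains (k l n m : nat)
    (P : 'M[bool]_(k, l)) (A : 'M[bool]_(n, m)) : bool :=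
  [exists r : {ffun 'I_k -> 'I_n}, exists c : {ffun 'I_l -> 'I_m},
    [&& increasing r, increasing c &
        [forall i, forall j, P i j ==> A (r i) (c j)]]].

Definition avoids (k l n m : nat)
    (P : 'M[bool]_(k, l)) (A : 'M[bool]_(n, m)) : bool := ~~ contains P A.

Definition ones (n m : nat) (A : 'M[bool]_(n, m)) : nat :=
  #|[set ij : 'I_n * 'I_m | A ij.1 ij.2]|.

(* If no matrix avoids P (only possible when P has no 1), this is 0. *)
Definition Ex2 (k l : nat) (P : 'M[bool]_(k, l)) (n m : nat) : nat :=
  \max_(A : 'M[bool]_(n, m) | avoids P A) ones A.

Definition Ex (k l : nat) (P : 'M[bool]_(k, l)) (n : nat) : nat := Ex2 P n n.

Definition hat : 'M[bool]_(2, 3) :=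
  \matrix_(i < 2, j < 3)
    nth false (nth [::] [:: [:: false; true;  false];
                            [:: true;  false; true ]] i) j.

(* In A *t B, row a * p + b (b < p, B having p rows) comes from row a of A and
   row b of B, and likewise for columns: block (i, j) is B if A i j, and zero
   otherwise.  The size 2k x 3l appears as (k * 2, k * 3). *)
Definition perm_hat (k : nat) (pi : {perm 'I_k}) : 'M[bool]_(k * 2, k * 3) :=
  (perm_mx pi *t hat)%R.

(* Only indices i, j >= 1 are meaningful; the recursion on j for i >= 2 is the
   iteration of w |-> w * a_{i-1,w} started at a_{i,1} = 2. *)
Fixpoint ack (i j : nat) : nat :=
  match i with
  | 0 => 0
  | 1 => 2 ^ j
  | i'.+1 => iter j.-1 (fun w => w * ack i' w) 2
  end.

Lemma ack1 j : ack 1 j = 2 ^ j. Proof. by []. Qed.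

Lemma ackS1 i : 2 <= i -> ack i 1 = 2. Proof. by case: i => [|[]]. Qed.

Lemma ackSS i j : 2 <= i -> 2 <= j ->
  ack i j = ack i j.-1 * ack i.-1 (ack i j.-1).
Proof. by case: i => [|[|i]] //; case: j => [|[|j]]. Qed.

Lemma ack_gt0 i j : 0 < i -> 0 < ack i j.
Proof.
case: i => // i _; elim: i j => [|i IHi] j; first by rewrite ack1 expn_gt0.
have [j2|] := leqP 2 j; last by case: j => [|[|]].
elim: j j2 => // -[//|j] IHj _; rewrite ackSS // muln_gt0 IHi andbT.
by case: j IHj => [|j] IHj; [rewrite ackS1 | exact: IHj].
Qed.

Lemma leq_ackS i j : 0 < i -> 0 < j -> ack i j <= ack i j.+1.
Proof.
case: i => [|[|i]] // _ j0; first by rewrite !ack1 leq_exp2l.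
by rewrite [leqRHS]ackSS // leq_pmulr // ack_gt0.
Qed.

Lemma ack_2 i : 0 < i -> ack i 2 = 2 ^ i.+1.
Proof.
elim: i => // -[|i] IHi _ //.
by rewrite ackSS // [i.+2.-1]/= [2.-1]/= ackS1 // IHi // -expnS.
Qed.

Lemma leq_ack i j : 0 < i -> 2 <= j -> i <= ack i j.
Proof.
move=> i0; elim: j => // -[//|[|j]] IHj _.
  by rewrite ack_2 // ltnW // (ltn_trans _ (ltn_expl _ _)).
by apply: leq_trans (leq_ackS _ _) => //; exact: IHj.
Qed.

(* (n + m.-1) %/ m is the ceiling of n / m for m >= 1. *)
Definition alpha_col (n m : nat) : nat := maxn 3 ((n + m.-1) %/ m).

Lemma alpha_subproof (n m : nat) :
  exists i, (1 <= i) && (m <= ack i (alpha_col n m)).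
Proof.
exists m.+1; rewrite /=; apply: ltnW; apply: leq_ack => //.
by rewrite /alpha_col leq_max.
Qed.

Definition alpha2 (n m : nat) : nat := ex_minn (alpha_subproof n m).

Definition alpha (n : nat) : nat := alpha2 n n.

(* Main.v *)
(* Q = P (x) H has a single 1 in each column, so it is coded by the list of rows
   of these 1s, and merging consecutive columns of a matrix avoiding Q preserves avoidance.
   Let W be a contiguous sublist of Q of length l.  Cut the m columns into slabs of width s.
   A row meeting one slab only is handled by induction.  In a slab where a row has its first
   (last) 1s while continuing elsewhere, the last (first) 1 of W comes for free, and in the
   middle slabs both do.  A hat-free slab with n nonempty rows has at most 2n + s ones, so in
   the middle slabs one cuts the rows, in groups of s, into maximal hat-free intervals.  The
   hats found between consecutive intervals avoid a k x k interval minor, so their number is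
   2^O(k) (n/s + m/s) by a variant of Fox's bound for permutation matrices; the groups on
   which the hats close contain only 2^O(k) (n + m) rows, and there W may be replaced by W
   without its two ends.  So the coefficient x(l,i) of n at level i of the Ackermann hierarchy
   obeys x(l,i) = 2 x(l,i-1) + 2 x(l-1,i) + 2^O(k) (1 + x(l-2,i)): the first term yields
   2^alpha, the other two yield max(2^O(k), alpha)^(3k-2).  The coefficient of m is made
   harmless by merging columns once more at the start. *)
Require Import Defs.
From mathcomp Require Import all_boot all_order all_algebra all_fingroup.
From mathcomp Require Import mxtens boolp zify.

Set Implicit Arguments.
Unset Strict Implicit.
Unset Printing Implicit Defensive.

(** * Interval minors *)

Lemma index_iota_cat a b c : a <= b -> b <= c ->
  index_iota a c = index_iota a b ++ index_iota b c.
Proof.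
move=> ab bc; rewrite /index_iota.
have -> : c - a = (b - a) + (c - b) by lia.
by rewrite iotaD; have -> : a + (b - a) = b by lia.
Qed.

Lemma count_cuts (P : pred nat) (cut : nat -> nat) m :
  {homo cut : i j / i <= j} ->
  count P (index_iota (cut 0) (cut m)) =
  \sum_(q <- iota 0 m) count P (index_iota (cut q) (cut q.+1)).
Proof.
move=> hc; elim: m => [|m IH]; first by rewrite /index_iota subnn big_nil.
rewrite (index_iota_cat (b := cut m)) ?hc // count_cat IH.
by rewrite -[in RHS]addn1 iotaD big_cat /= big_cons big_nil addn0.
Qed.

(** [B x y u v] speaks of the block with rows in [[x, y)] and columns in [[u, v)]. For [box] this is
    an all-ones [k] by [l] interval minor; [B] stays abstract because the same grid serves below for
    pairs of marks. *)
Definition has_minor (k l : nat) (B : nat -> nat -> nat -> nat -> Prop) : Prop :=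
  exists rho kappa : nat -> nat,
    [/\ {homo rho : i j / i <= j}, {homo kappa : i j / i <= j} &
        forall i j, i < k -> j < l ->
          B (rho i) (rho i.+1) (kappa j) (kappa j.+1)].

Definition box (A : nat -> nat -> bool) (X : seq nat) (a b x y u v : nat) :=
  exists r c, [/\ r \in X, a <= c < b, x <= r < y, u <= c < v & A r c].

(** The sorted rows of [X] are themselves the cut points, so each interval contains the row that
    opens it. The strict inequality on [size X] supplies the cut point closing the last interval. *)
Lemma nonempty_rows_minor l A X a b : uniq X -> l < size X ->
  (forall r, r \in X -> has (A r) (index_iota a b)) ->
  has_minor l 1 (box A X a b).
Proof.
move=> uX lX hX; pose s := sort leq X.
have sX : size s = size X by rewrite size_sort.
have us : uniq s by rewrite sort_uniq.
have ms r : r \in s = (r \in X) by rewrite mem_sort.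
have so : sorted ltn s by rewrite ltn_sorted_uniq_leq us sort_sorted //; exact: leq_total.
have lts i j : i < j -> j < size s -> nth 0 s i < nth 0 s j.
  move=> ij js; apply: (sorted_ltn_nth ltn_trans 0 so i j) => //.
  by rewrite inE (ltn_trans ij).
exists (fun i => nth 0 s (minn i l)), (fun j => if j == 0 then a else b).
split=> [i j ij|i j ij|i j il].
- have [e|ne] := eqVneq (minn i l) (minn j l); first by rewrite e.
  apply: ltnW; apply: lts; rewrite ?sX; lia.
- case: i j ij => [|i] [|j] //= _.
  have /hX/hasP[c] : nth 0 X 0 \in X by rewrite mem_nth // (leq_ltn_trans _ lX).
  rewrite mem_index_iota; lia.
case: j => // _ /=.
have iX : minn i l < size s by rewrite sX; lia.
have rX : nth 0 s (minn i l) \in X by rewrite -ms mem_nth.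
have /hasP[c cab Ac] := hX _ rX.
exists (nth 0 s (minn i l)), c; split=> //; [by rewrite -mem_index_iota| |by rewrite -mem_index_iota].
rewrite leqnn /=; apply: lts; rewrite ?sX; lia.
Qed.

(* Fox's lemma.  Halve the columns: a row rich in one half and not empty in the other gives, by
   induction, a minor with one column fewer, the whole other half serving as the last column. *)
Lemma rich_rows_minor l k p b A X a : 0 < k -> k.-1 <= b -> uniq X ->
  (forall r, r \in X -> 2 ^ b <= count (A r) (index_iota a (a + 2 ^ p))) ->
  l * 4 ^ p < size X ->
  has_minor l k (box A X a (a + 2 ^ p)).
Proof.
elim: p k b X a => [|p IH] k b X a k0 kb uX hX sX;
  (have [k1|k1] := leqP k 1;
    [have -> : k = 1 by lia |]).
- apply: nonempty_rows_minor => //; first by rewrite muln1 in sX.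
  move=> r /hX; rewrite has_count; apply: leq_trans; by rewrite expn_gt0.
- have /hX h : nth 0 X 0 \in X by rewrite mem_nth // (leq_ltn_trans _ sX).
  have := leq_trans h (count_size _ _); rewrite size_iota addKn expn0.
  have : 2 ^ 1 <= 2 ^ b by rewrite leq_exp2l; lia.
  lia.
- apply: nonempty_rows_minor => //.
    apply: leq_trans sX; rewrite ltnS leq_pmulr // expn_gt0 //.
  move=> r /hX; rewrite has_count; apply: leq_trans; by rewrite expn_gt0.
have b0 : 0 < b by lia.
have e2 : 2 ^ p.+1 = 2 ^ p + 2 ^ p by rewrite expnS; lia.
have e2b : 2 ^ b = 2 ^ b.-1 + 2 ^ b.-1.
  by rewrite -[in LHS](prednK b0) expnS; lia.
pose mid := a + 2 ^ p.
have em : a + 2 ^ p.+1 = mid + 2 ^ p by rewrite e2 addnA.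
pose cL r := count (A r) (index_iota a mid).
pose cR r := count (A r) (index_iota mid (mid + 2 ^ p)).
have cE r : count (A r) (index_iota a (a + 2 ^ p.+1)) = cL r + cR r.
  rewrite em (index_iota_cat (b := mid)) ?leq_addr // count_cat //.
pose X1 := [seq r <- X | cR r == 0].
pose X2 := [seq r <- X | cL r == 0].
pose X3 := [seq r <- X | (2 ^ b.-1 <= cL r) && (0 < cR r)].
pose X4 := [seq r <- X | (2 ^ b.-1 <= cR r) && (0 < cL r)].
(* A row with at least [2 ^ b] ones has at least [2 ^ b.-1] of them in one half, and its other half
   is empty or not. The four classes cover [X], hence the factor 4 per halving. *)
have sz : size X <= size X1 + size X2 + size X3 + size X4.
  rewrite !size_filter.
  elim: (X) hX => //= r Y IHY hY.
  have {IHY}/IHY := fun x h => hY x (mem_behead (s := r :: Y) h).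
  have := hY r (mem_head _ _); rewrite cE e2b.
  have : 0 < 2 ^ b.-1 by rewrite expn_gt0.
  set A1 := count _ Y; set A2 := count _ Y; set A3 := count _ Y; set A4 := count _ Y.
  set B := 2 ^ b.-1; move: (cL r) (cR r) B => u v B.
  lia.
have [h1|h1] := leqP (size X1) (l * 4 ^ p); last first.
  have [|x|rho [kap [hr hk hB]]] := IH k b X1 a k0 kb _ _ h1.
  - exact: filter_uniq.
  - rewrite mem_filter => /andP[/eqP c0 /hX]; rewrite cE c0 addn0 //.
  exists rho, kap; split=> // i j il jk; have [r [c [rX cab ? ? ?]]] := hB i j il jk.
  exists r, c; split=> //; first by move: rX; rewrite mem_filter => /andP[].
  rewrite e2; lia.
have [h2|h2] := leqP (size X2) (l * 4 ^ p); last first.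
  have [|x|rho [kap [hr hk hB]]] := IH k b X2 mid k0 kb _ _ h2.
  - exact: filter_uniq.
  - rewrite mem_filter => /andP[/eqP c0 /hX]; rewrite cE c0 //.
  exists rho, kap; split=> // i j il jk; have [r [c [rX cab ? ? ?]]] := hB i j il jk.
  exists r, c; split=> //; first by move: rX; rewrite mem_filter => /andP[].
  rewrite em /mid in cab *; lia.
have k10 : 0 < k.-1 by lia.
have kb1 : k.-1.-1 <= b.-1 by lia.
have [h3|h3] := leqP (size X3) (l * 4 ^ p); last first.
  have [|x|rho [kap [hr hk hB]]] := IH k.-1 b.-1 X3 a k10 kb1 _ _ h3.
  - exact: filter_uniq.
  - by rewrite mem_filter => /andP[/andP[]].
  exists rho, (fun j => if j < k then minn (kap j) mid else a + 2 ^ p.+1).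
  split=> // [i j ij|i j il jk].
    have := hk _ _ ij; case: ifP; case: ifP; rewrite ?em; lia.
  rewrite jk; have [jk1|jk1] := ltnP j.+1 k.
    have [|r [c [rX cab ? ? ?]]] := hB i j il; first by lia.
    exists r, c; split=> //; [by move: rX; rewrite mem_filter => /andP[]|..].
      rewrite e2; lia.
    rewrite -/mid in cab; lia.
  (* In the last block column, the whole right half, any row found in the [i]-th row interval will
     do: rows of [X3] have a 1 there. *)
  have [r [c [rX cab ir _ _]]] := hB i 0 il k10.
  move: rX; rewrite mem_filter => /andP[/andP[_]]; rewrite -has_count => /hasP[d].
  rewrite mem_index_iota -em => dm Ad rX.
  exists r, d; split=> //; rewrite /mid in dm *; lia.
have [h4|h4] := leqP (size X4) (l * 4 ^ p); last first.
  have [|x|rho [kap [hr hk hB]]] := IH k.-1 b.-1 X4 mid k10 kb1 _ _ h4.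
  - exact: filter_uniq.
  - by rewrite mem_filter => /andP[/andP[]].
  exists rho, (fun j => if j == 0 then a else maxn (kap j.-1) mid).
  split=> // [i j ij|i j il jk].
    have := @hk i.-1 j.-1; case: eqP; case: eqP; rewrite /mid; lia.
  case: j jk => [|j] /= jk; last first.
    have [|r [c [rX cab ? ? ?]]] := hB i j il; first by lia.
    exists r, c; split=> //; [by move: rX; rewrite mem_filter => /andP[]|..].
      rewrite em /mid in cab *; lia.
    lia.
  have [r [c [rX cab ir _ _]]] := hB i 0 il k10.
  move: rX; rewrite mem_filter => /andP[/andP[_]]; rewrite -has_count => /hasP[d].
  rewrite mem_index_iota => dm Ad rX.
  exists r, d; split=> //; rewrite ?em /mid in dm *; lia.
move: sX; rewrite expnS; lia.
Qed.

(** * A linear bound on the 1s of a matrix without a large interval minor *)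

Definition ones_in (A : nat -> nat -> bool) (X : seq nat) (a b : nat) : nat :=
  \sum_(r <- X) count (A r) (index_iota a b).

Definition merge_cols (A : nat -> nat -> bool) (cut : nat -> nat) (r q : nat) :=
  has (A r) (index_iota (cut q) (cut q.+1)).

Lemma ones_in_cuts A X (cut : nat -> nat) m : {homo cut : i j / i <= j} ->
  ones_in A X (cut 0) (cut m) =
  \sum_(q <- iota 0 m) ones_in A X (cut q) (cut q.+1).
Proof.
move=> hc; rewrite /ones_in exchange_big /=.
by apply: eq_bigr => r _; exact: count_cuts.
Qed.

Lemma count_sum (T : Type) (P : pred T) s : count P s = \sum_(x <- s) P x.
Proof. by rewrite -sum1_count big_mkcond. Qed.

Lemma sum_const_seq (T : Type) (s : seq T) c : \sum_(x <- s) c = size s * c.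
Proof. by rewrite big_const_seq count_predT iter_addn_0 mulnC. Qed.

Lemma ones_in_sum A X a b :
  ones_in A X a b = \sum_(r <- X) \sum_(c <- index_iota a b) A r c.
Proof. by apply: eq_bigr => r _; rewrite count_sum. Qed.

Lemma sub_minor k l (B B' : nat -> nat -> nat -> nat -> Prop) :
  (forall x y u v, B x y u v -> B' x y u v) ->
  has_minor k l B -> has_minor k l B'.
Proof.
move=> h [rho [kap [hr hk hB]]]; exists rho, kap; split=> // i j il jk.
exact/h/hB.
Qed.

Lemma minor_transpose k l B : has_minor k l B ->
  has_minor l k (fun x y u v => B u v x y).
Proof.
by move=> [rho [kap [hr hk hB]]]; exists kap, rho; split=> // i j il jk; exact: hB.
Qed.

Lemma minor_merge_cols k l A X (cut : nat -> nat) m : {homo cut : i j / i <= j} ->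
  has_minor k l (box (merge_cols A cut) X 0 m) ->
  has_minor k l (box A X (cut 0) (cut m)).
Proof.
move=> hc [rho [kap [hr hk hB]]]; exists rho, (fun j => cut (kap j)).
split=> // [i j ij|i j il jk]; first exact/hc/hk.
have [r [q [rX qm ri qj /hasP[c]]]] := hB _ _ il jk.
rewrite mem_index_iota => cq Ac; exists r, c; split=> //.
  have := hc _ _ (leq0n q); have : cut q.+1 <= cut m by apply: hc; lia.
  lia.
have /hc : kap j <= q by lia.
have /hc : q.+1 <= kap j.+1 by lia.
lia.
Qed.

(** Call a row wide in a slab of [4 ^ k] columns if it has at least [2 ^ k.-1] ones there. By
    [rich_rows_minor] with [p = 2k], a slab has at most [k * 16 ^ k] wide rows, each with at most
    [4 ^ k] ones; any other nonempty row trades fewer than [2 ^ k.-1] ones for a single 1 of the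
    merged matrix. *)
Lemma merge_step k A n m : 0 < k ->
  ~ has_minor k k (box A (iota 0 n) 0 (m * 4 ^ k)) ->
  ones_in A (iota 0 n) 0 (m * 4 ^ k) <=
  2 ^ k.-1 * ones_in (merge_cols A (fun q => q * 4 ^ k)) (iota 0 n) 0 m
  + k * 16 ^ k * (m * 4 ^ k).
Proof.
move=> k0 nm; set t := 4 ^ k; pose cut q := q * t.
have hc : {homo cut : i j / i <= j} by move=> i j ij; rewrite leq_mul2r ij orbT.
rewrite -[0 in X in X <= _]/(cut 0) -[m * t in X in X <= _]/(cut m).
rewrite ones_in_cuts //.
have -> : ones_in (merge_cols A cut) (iota 0 n) 0 m =
    \sum_(q <- iota 0 m) \sum_(r <- iota 0 n) merge_cols A cut r q.
  by rewrite ones_in_sum exchange_big /index_iota subn0.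
have -> : k * 16 ^ k * (m * t) = \sum_(q <- iota 0 m) k * 16 ^ k * t.
  by rewrite sum_const_seq size_iota; lia.
rewrite big_distrr -big_split /=.
rewrite big_seq [leqRHS]big_seq; apply: leq_sum => q; rewrite mem_iota add0n => qm.
pose wide r := 2 ^ k.-1 <= count (A r) (index_iota (cut q) (cut q.+1)).
pose X := [seq r <- iota 0 n | wide r].
have cS : cut q.+1 = cut q + 2 ^ (k + k) by rewrite /cut mulSn addnC /t -(expnM 2 2); congr (_ + 2 ^ _); lia.
have ct : cut q.+1 - cut q = t by rewrite /cut mulSn addnK.
have sX : size X <= k * 16 ^ k.
  rewrite leqNgt; apply/negP => h; apply: nm.
  have [|r||rho [kap [hr hk hB]]] := @rich_rows_minor k k (k + k) k.-1 A X (cut q) k0 (leqnn _).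
  - by rewrite filter_uniq // iota_uniq.
  - by rewrite mem_filter -cS => /andP[].
  - by rewrite addnn -mul2n expnM.
  exists rho, kap; split=> // i j il jk; have [r [c [rX cab ? ? ?]]] := hB i j il jk.
  exists r, c; split=> //; first by move: rX; rewrite mem_filter => /andP[].
  have : cut q.+1 <= cut m by apply: hc; lia.
  rewrite -cS in cab; rewrite -/t /cut in cab *; lia.
apply: leq_trans (_ : _ <= 2 ^ k.-1 * (\sum_(r <- iota 0 n) merge_cols A cut r q) + size X * t) _; last first.
  by rewrite leq_add2l leq_mul2r sX orbT.
rewrite /ones_in size_filter count_sum big_distrr big_distrl -big_split /=.
apply: leq_sum => r _; rewrite /merge_cols has_count -/(wide r).
have := count_size (A r) (index_iota (cut q) (cut q.+1)); rewrite size_iota ct.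
rewrite /wide; set cc := count _ _; case: (leqP (2 ^ k.-1) cc) => [_|lt] le.
  by rewrite mul1n; apply: leq_trans le _; exact: leq_addl.
by rewrite mul0n addn0; case: (cc) lt => [|x] /ltnW // lt; rewrite muln1.
Qed.

Lemma ones_transpose A n m :
  ones_in (fun c r => A r c) (iota 0 m) 0 n = ones_in A (iota 0 n) 0 m.
Proof. by rewrite !ones_in_sum exchange_big /index_iota !subn0. Qed.

Lemma box_transpose A n m x y u v :
  box (fun c r => A r c) (iota 0 m) 0 n x y u v ->
  box A (iota 0 n) 0 m u v x y.
Proof.
move=> [r [c [h1 h2 h3 h4 h5]]]; exists c, r; split=> //; first by rewrite mem_iota.
by move: h1; rewrite mem_iota.
Qed.

Lemma sq_pow k : 0 < k -> 4 * (2 ^ k.-1 * 2 ^ k.-1) = 4 ^ k.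
Proof.
by case: k => // k _; rewrite -expnMn expnS.
Qed.

(* Merging 4^k columns loses a factor 2^(k-1), as does merging 4^k rows, while the number of
   blocks decreases by a factor 4^k > 2^(k-1) * 2^(k-1); hence the bound is linear. *)
Lemma ones_minor_free k p A : 0 < k ->
  ~ has_minor k k (box A (iota 0 ((4 ^ k) ^ p)) 0 ((4 ^ k) ^ p)) ->
  ones_in A (iota 0 ((4 ^ k) ^ p)) 0 ((4 ^ k) ^ p) <=
  4 * (2 ^ k.-1 * (k * 16 ^ k)) * (4 ^ k) ^ p.
Proof.
move=> k0; have e4 := sq_pow k0.
have s0 : 0 < 2 ^ k.-1 by rewrite expn_gt0.
have f0 : 0 < k * 16 ^ k by rewrite muln_gt0 k0 expn_gt0.
elim: p A => [|p IH] A.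
  rewrite expn0 muln1 /ones_in /index_iota /= big_cons big_nil /= => _.
  apply: leq_trans (_ : 1 <= _); first by case: (A 0 0).
  by rewrite muln_gt0 /= muln_gt0 s0.
set t := 4 ^ k in IH e4 *; set N := t ^ p in IH *.
rewrite expnSr -/N => nm.
pose cut q := q * t.
have hc : {homo cut : i j / i <= j} by move=> i j ij; rewrite leq_mul2r ij orbT.
apply: leq_trans (merge_step k0 nm) _; rewrite -/t.
set A1 := merge_cols _ _.
(* Rows are merged by merging the columns of the transpose. *)
have nm1 : ~ has_minor k k (box (fun c r => A1 r c) (iota 0 N) 0 (N * t)).
  move=> /minor_transpose h; apply/nm/(@minor_merge_cols _ _ A _ cut N) => //.
  by apply: sub_minor h => x y u v; exact: box_transpose.
have := merge_step k0 nm1; rewrite -/t (ones_transpose A1).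
set A2 := merge_cols _ _ => h1.
have /IH h2 : ~ has_minor k k (box A2 (iota 0 N) 0 N).
  by move=> /(@minor_merge_cols _ _ _ _ cut N hc) /nm1.
have h3 := leq_mul (leqnn (2 ^ k.-1)) h1.
have h4 := leq_mul (leqnn (2 ^ k.-1 * 2 ^ k.-1)) h2.
clear IH nm nm1 h1 h2; clearbody A2 A1; clearbody N; clearbody t.
move: (ones_in _ _ _ _) (ones_in _ _ _ _) h3 h4 => o1 o2.
move: e4 s0 f0; move: (2 ^ k.-1) (k * 16 ^ k) => s f e4 s0 f0 h3 h4.
(* Here [t = 4 * (s * s)]. The induction hypothesis and the two merges contribute at most
   [s * f * (N * t)] each, so the constant [4 * (s * f)] is preserved. *)
have : s * (s * o1) <= t * (s * f) * N by rewrite -e4; lia.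
have : f * (N * t) <= s * f * (N * t) by rewrite leq_mul2r leq_pmull ?orbT.
rewrite mulnDr in h3; lia.
Qed.

(** * Interval minors of families of row intervals *)

Definition chain (s : seq (nat * nat)) : bool :=
  all (fun i => i.1 < i.2) s && pairwise (fun i j => i.2 <= j.1) s.

Definition inside (x y : nat) (i : nat * nat) : bool := (x <= i.1) && (i.2 < y).

(* An item (x, y) of I q stands for two marks x < y in column q; consecutive items may share a
   mark, and an item lies in a block when both marks do. *)
Definition item_box (I : nat -> seq (nat * nat)) (m x y u v : nat) : Prop :=
  exists q i, [/\ q < m, u <= q < v, i \in I q & inside x y i].

Lemma chain_filter (P : pred (nat * nat)) s : chain s -> chain (filter P s).
Proof.
move=> /andP[h1 h2]; apply/andP; split; last exact: pairwise_filter.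
by apply/allP => i; rewrite mem_filter => /andP[_ /(allP h1)].
Qed.

Lemma chain_size s a b : chain s -> a <= b ->
  (forall i, i \in s -> inside a b i) -> size s <= b - a.
Proof.
rewrite /chain; elim: s a => [|i s IH] a //= /andP[/andP[i12 h1] /andP[h2 h3]] ab hs.
have := hs i (mem_head _ _); rewrite /inside => /andP[ai ib].
have : size s <= b - i.2.
  apply: IH; rewrite ?h1 ?h3 //; first exact: ltnW.
  move=> j js; rewrite /inside (allP h2) //=.
  have := hs j; rewrite inE js orbT => /(_ isT) /andP[] //.
lia.
Qed.

(** Two consecutive items can share the mark [p]; with a third, the nonempty middle one would have
    both ends equal to [p]. *)
Lemma chain_touch s p : chain s -> count (fun i => i.1 <= p <= i.2) s <= 2.
Proof.
move=> /(chain_filter (fun i => i.1 <= p <= i.2)).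
have : all (fun i => i.1 <= p <= i.2) (filter (fun i => i.1 <= p <= i.2) s).
  exact: filter_all.
rewrite -size_filter /chain; case: filter => [|i [|j [|l u]]] //=; lia.
Qed.

Lemma sum_max_le (T : eqType) (u : seq T) (f : T -> nat) :
  u = [::] \/ exists2 c, c \in u & \sum_(x <- u) f x <= count (fun x => 0 < f x) u * f c.
Proof.
have [->|u0] := eqVneq u [::]; [by left | right].
have [c cu hc] : exists2 c, c \in u & forall x, x \in u -> f x <= f c.
  elim: u u0 => // x [|y u] IH _; first by exists x; rewrite ?mem_head // => z; rewrite inE => /eqP->.
  have [//|c cu hc] := IH.
  have [xc|cx] := leqP (f x) (f c).
    exists c; first by rewrite inE cu orbT.
    by move=> z; rewrite inE => /orP[/eqP->//|/hc].
  exists x; rewrite ?mem_head // => z; rewrite inE => /orP[/eqP->//|/hc h].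
  by apply: leq_trans h (ltnW cx).
exists c => //; rewrite count_sum big_distrl /= big_seq [leqRHS]big_seq.
apply: leq_sum => x /hc; case: (f x) => //= y; lia.
Qed.

Definition wide (I : nat -> seq (nat * nat)) (a t s x y : nat) : bool :=
  s <= count (fun c => has (inside x y) (I c)) (iota a t).

Lemma narrow_best (I : nat -> seq (nat * nat)) a t s x y :
  (forall c, a <= c < a + t -> chain (I c)) -> ~~ wide I a t s x y ->
  exists L, [/\ chain L,
    forall i, i \in L -> inside x y i /\ exists2 c, a <= c < a + t & i \in I c &
    \sum_(c <- iota a t) count (inside x y) (I c) <= s * size L].
Proof.
move=> hI; rewrite -ltnNge => nw.
have [e|[c cu hc]] := sum_max_le (iota a t) (fun c => count (inside x y) (I c)).
  by exists [::]; split=> //; rewrite e big_nil.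
move: cu; rewrite mem_iota => cu.
exists (filter (inside x y) (I c)); split; first exact/chain_filter/hI.
  by move=> i; rewrite mem_filter => /andP[-> ic]; split=> //; exists c.
apply: leq_trans hc _; rewrite size_filter leq_mul2r; apply/orP; right.
by apply: leq_trans (ltnW nw); apply: sub_count => z /=; rewrite -has_count.
Qed.

(* Cut the rows greedily at the shortest wide prefix.  In each zone without its last row fewer
   than s columns have an item, so the best column keeps a fraction 1/s of the items. *)
Lemma zones (I : nat -> seq (nat * nat)) a t s n : 0 < s ->
  (forall c, a <= c < a + t -> chain (I c)) -> forall z0, z0 <= n ->
  exists N (zeta : nat -> nat) L,
    [/\ {homo zeta : i j / i <= j}, zeta 0 = z0,
        forall i, i < N -> wide I a t s (zeta i) (zeta i.+1), chain L &
        (forall i, i \in L -> inside z0 n i /\ exists2 c, a <= c < a + t & i \in I c)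
        /\ \sum_(c <- iota a t) count (inside z0 n) (I c) <= s * size L + 2 * t * N].
Proof.
move=> s0 hI z0; have [d] := ubnP (n - z0); elim: d z0 => // d IH z0 dn z0n.
have [w|nw] := boolP (wide I a t s z0 n); last first.
  have [L [cL hL sL]] := narrow_best hI nw.
  exists 0, (fun _ => z0), L; split=> //; split=> //.
  by rewrite muln0 addn0.
have ex : exists z, wide I a t s z0 z by exists n.
have [z wz minz] := ex_minnP ex.
have zn : z <= n by exact: minz.
have z0z : z0 < z.
  rewrite ltnNge; apply/negP => zz0; move: wz; rewrite /wide leqNgt; apply/negP.
  rewrite negbK; apply: leq_trans s0; rewrite ltnS leqn0 -leqn0 leqNgt -has_count.
  apply/negP => /hasP[c]; rewrite mem_iota => /hI /andP[/allP cI _] /hasP[i /cI].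
  rewrite /inside; lia.
have nw : ~~ wide I a t s z0 z.-1 by apply/negP => /minz; lia.
have [L0 [cL0 hL0 sL0]] := narrow_best hI nw.
have [||N [zeta [L [hz z_0 hw cL [hL sL]]]]] := IH z; [lia|by []|].
exists N.+1, (fun i => if i is j.+1 then zeta j else z0), (L0 ++ L); split=> //.
- move=> [|i] [|j] //= ij; last exact: hz.
  by apply: leq_trans (ltnW z0z) _; rewrite -z_0 hz.
- by case=> [|i] //= iN; [rewrite z_0 | exact: hw].
- move: cL0 cL => /andP[h1 h2] /andP[h3 h4].
  rewrite /chain all_cat pairwise_cat h1 h2 h3 h4 /= andbT.
  apply/allrelP => i j /hL0[+ _] /hL[+ _]; rewrite /inside; lia.
split=> [i|].
  by rewrite mem_cat => /orP[/hL0|/hL] [p h]; split=> //; move: p; rewrite /inside; lia.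
rewrite size_cat mulnS mulnDr.
(* An item that lies on neither side of row [z.-1] touches it. Each column has at most two of these,
   whence the loss [2 * t] per zone. *)
apply: leq_trans (_ : _ <= \sum_(c <- iota a t) (count (inside z0 z.-1) (I c) + count (inside z n) (I c) + 2)) _.
  rewrite big_seq [leqRHS]big_seq; apply: leq_sum => c; rewrite mem_iota => /hI cI.
  apply: leq_trans (_ : _ <= count (inside z0 z.-1) (I c) + count (inside z n) (I c)
      + count (fun i => i.1 <= z.-1 <= i.2) (I c)) _; last by rewrite leq_add2l chain_touch.
  have : {in I c, forall i, i.1 < i.2} by apply/allP; case/andP: cI.
  elim: (I c) => //= i u IHu hu.
  have /IHu : {in u, forall i, i.1 < i.2} by move=> j ju; apply: hu; rewrite inE ju orbT.
  have := hu i (mem_head _ _); rewrite /inside; lia.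
rewrite !big_split /= sum_const_seq size_iota; lia.
Qed.

Definition items_in (I : nat -> seq (nat * nat)) (n m : nat) : Prop :=
  forall q, q < m -> chain (I q) /\ forall i, i \in I q -> i.2 < n.

Lemma sum_cuts (F : nat -> nat) t m :
  \sum_(c <- iota 0 (m * t)) F c =
  \sum_(q <- iota 0 m) \sum_(c <- iota (q * t) t) F c.
Proof.
elim: m => [|m IH]; first by rewrite !big_nil.
by rewrite mulSnr iotaD big_cat IH -addn1 iotaD big_cat /= big_cons big_nil addn0.
Qed.

(** The wide zones of a slab are the rows of a matrix whose 1s tell which columns have an item
    inside the zone. A minor of this matrix is a minor of [I], so [rich_rows_minor] allows at most
    [k * 16 ^ k] wide zones; [zones] does the rest. *)
Lemma merge_items k I n m : 0 < k -> items_in I n (m * 4 ^ k) ->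
  ~ has_minor k k (item_box I (m * 4 ^ k)) ->
  exists L, [/\ items_in L n m, ~ has_minor k k (item_box L m) &
    \sum_(c <- iota 0 (m * 4 ^ k)) size (I c) <=
    2 ^ k.-1 * (\sum_(q <- iota 0 m) size (L q)) + 2 * (k * 16 ^ k) * (m * 4 ^ k)].
Proof.
move=> k0; set t := 4 ^ k => hI nm.
have s0 : 0 < 2 ^ k.-1 by rewrite expn_gt0.
have hq q : exists L : seq (nat * nat), q < m ->
    [/\ chain L,
      forall i, i \in L -> i.2 < n /\ exists2 c, q * t <= c < q * t + t & i \in I c &
      \sum_(c <- iota (q * t) t) size (I c) <=
      2 ^ k.-1 * size L + 2 * (k * 16 ^ k) * t].
  have [qm|] := ltnP q m; last by exists [::].
  have qtm c : c < q * t + t -> c < m * t.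
    by move=> /leq_trans; apply; rewrite -mulSnr leq_mul2r qm orbT.
  have hIc c : q * t <= c < q * t + t -> chain (I c).
    by move=> /andP[_ /qtm /hI[]].
  have [N [zeta [L [hz z0 hw cL [hL sL]]]]] := zones s0 hIc (leq0n n).
  exists L => _; split=> //.
  have NN : N <= k * 16 ^ k.
    rewrite leqNgt; apply/negP => hN; apply: nm.
    pose A i c := has (inside (zeta i) (zeta i.+1)) (I c).
    have [|i||rho [kap [hr hk hB]]] := @rich_rows_minor k k (k + k) k.-1 A (iota 0 N) (q * t) k0 (leqnn _).
    - exact: iota_uniq.
    - rewrite mem_iota => /andP[_ /hw].
      by rewrite /wide /index_iota addKn addnn -mul2n expnM.
    - by rewrite size_iota addnn -mul2n expnM.
    exists (fun i => zeta (rho i)), kap; split=> // [i j ij|i j il jk]; first exact/hz/hr.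
    have [r [c [rN cab rr cc /hasP[it itI inz]]]] := hB i j il jk.
    rewrite addnn -mul2n expnM -/t in cab.
    exists c, it; split=> //; first by apply: qtm; lia.
    move: inz; rewrite /inside.
    have /hz : rho i <= r by lia.
    have /hz : r.+1 <= rho i.+1 by lia.
    lia.
  apply: leq_trans (_ : _ <= \sum_(c <- iota (q * t) t) count (inside 0 n) (I c)) _.
    rewrite big_seq [leqRHS]big_seq; apply: leq_sum => c; rewrite mem_iota => /andP[_ /qtm /hI[_ h]].
    by apply/eq_leq/esym/eqP; rewrite -all_count; apply/allP => i /h; rewrite /inside.
  apply: leq_trans sL _; rewrite leq_add2l; nia.
have [L hL] := choice hq; exists L; split.
- by move=> q /hL[h1 h2 _]; split=> // i /h2[].
- move=> [rho [kap [hr hk hB]]]; apply: nm.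
  exists rho, (fun j => t * kap j); split=> // [i j ij|i j il jk].
    by rewrite leq_mul2l hk ?orbT.
  have [q [it [qm qj itL itin]]] := hB _ _ il jk.
  have [_ h2 _] := hL _ qm; have [_ [c cq itI]] := h2 _ itL.
  exists c, it; split=> //.
    have : q.+1 * t <= m * t by rewrite leq_mul2r qm orbT.
    lia.
  have : q.+1 * t <= kap j.+1 * t by rewrite leq_mul2r; apply/orP; right; lia.
  have : kap j * t <= q * t by rewrite leq_mul2r; apply/orP; right; lia.
  lia.
rewrite sum_cuts.
have -> : 2 * (k * 16 ^ k) * (m * t) = \sum_(q <- iota 0 m) 2 * (k * 16 ^ k) * t.
  by rewrite sum_const_seq size_iota; lia.
rewrite big_distrr -big_split /= big_seq [leqRHS]big_seq; apply: leq_sum => q.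
by rewrite mem_iota => /hL[].
Qed.

(** Rows are taken in groups of [t]. An item whose marks fall in different groups survives as an
    item between groups. The others lie inside one group, at most [t] per group and column, and [A]
    records where they occur. Both images inherit the absence of the minor. *)
Lemma contract_items k I n m t : 0 < t -> items_in I (n * t) m ->
  ~ has_minor k k (item_box I m) ->
  exists L A, [/\ items_in L n m, ~ has_minor k k (item_box L m),
    ~ has_minor k k (box A (iota 0 n) 0 m) &
    \sum_(q <- iota 0 m) size (I q) <=
    \sum_(q <- iota 0 m) size (L q) + t * ones_in A (iota 0 n) 0 m].
Proof.
move=> t0 hI nm.
pose long (i : nat * nat) := i.1 %/ t < i.2 %/ t.
pose short g (i : nat * nat) := (i.1 %/ t == g) && (i.2 %/ t == g).
pose L q := [seq (i.1 %/ t, i.2 %/ t) | i <- I q & long i].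
pose A g q := has (short g) (I q).
have lo x a : a <= x %/ t -> a * t <= x by rewrite leq_divRL.
have hi x b : x %/ t < b -> x < b * t by rewrite ltn_divLR.
exists L, A; split.
- move=> q qm; have [cI bI] := hI q qm; split; last first.
    move=> _ /mapP[i + ->]; rewrite mem_filter => /andP[_ /bI] /=.
    by rewrite ltn_divLR.
  rewrite /chain all_map pairwise_map; apply/andP; split.
    by apply/allP => i; rewrite mem_filter => /andP[].
  have /andP[_] := chain_filter long cI.
  apply: sub_pairwise => i j /=; exact: leq_div2r.
- move=> [rho [kap [hr hk hB]]]; apply: nm.
  exists (fun i => rho i * t), kap; split=> // [i j ij|i j il jk].
    by rewrite leq_mul2r hr ?orbT.
  have [q [_ [qm qj /mapP[it + ->]]]] := hB _ _ il jk.
  rewrite mem_filter => /andP[_ itI] /andP[/= h1 h2].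
  exists q, it; split=> //; rewrite /inside lo //=; exact: hi.
- move=> [rho [kap [hr hk hB]]]; apply: nm.
  exists (fun i => rho i * t), kap; split=> // [i j ij|i j il jk].
    by rewrite leq_mul2r hr ?orbT.
  have [g [q [_ qm gr qj /hasP[it itI]]]] := hB _ _ il jk.
  rewrite /short => /andP[/eqP h1 /eqP h2].
  exists q, it; split=> //; rewrite /inside lo ?h1 //=; last by lia.
  by apply: hi; rewrite h2; lia.
have -> : ones_in A (iota 0 n) 0 m = \sum_(q <- iota 0 m) \sum_(g <- iota 0 n) A g q.
  by rewrite ones_in_sum exchange_big /index_iota subn0.
rewrite big_distrr -big_split /= big_seq [leqRHS]big_seq; apply: leq_sum => q.
rewrite mem_iota => /hI[cI bI].
rewrite size_map size_filter -(count_predC long (I q)) leq_add2l big_distrr /=.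
apply: leq_trans (_ : _ <= \sum_(g <- iota 0 n) count (short g) (I q)) _.
  rewrite !count_sum; under [leqRHS]eq_bigr do rewrite count_sum.
  rewrite exchange_big /= big_seq [leqRHS]big_seq; apply: leq_sum => i iI.
  have [//|nl] := boolP (long i).
  have /andP[/allP /(_ i iI) i12 _] := cI.
  have e : i.1 %/ t = i.2 %/ t.
    by apply/eqP; rewrite eqn_leq leq_div2r ?(ltnW i12) //= leqNgt.
  have gn : i.2 %/ t \in iota 0 n by rewrite mem_iota /= add0n ltn_divLR // bI.
  rewrite (big_rem _ gn) /= /short e !eqxx //.
apply: leq_sum => g _; rewrite /A has_count; case: ltnP => [_|]; last by rewrite muln0.
rewrite muln1 -size_filter -[leqRHS](addKn (g * t)).
apply: chain_size; [exact: chain_filter|exact: leq_addr|].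
move=> i; rewrite mem_filter => /andP[/andP[/eqP h1 /eqP h2] _].
rewrite /inside lo ?h1 //= -mulSnr; apply: hi; by rewrite h2.
Qed.

(** Merging columns costs the factor [s = 2 ^ k.-1], but contracting rows costs only the additive
    term controlled by [ones_minor_free]. As both sides shrink by [t = 4 ^ k] and [2 * s <= t], half
    of the constant pays for the induction hypothesis and half for the additive terms. *)
Lemma items_minor_free_pow k p I : 0 < k ->
  items_in I ((4 ^ k) ^ p) ((4 ^ k) ^ p) ->
  ~ has_minor k k (item_box I ((4 ^ k) ^ p)) ->
  \sum_(q <- iota 0 ((4 ^ k) ^ p)) size (I q) <=
  2 * (2 ^ k.-1 * (4 * (2 ^ k.-1 * (k * 16 ^ k))) + 2 * (k * 16 ^ k)) * (4 ^ k) ^ p.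
Proof.
move=> k0; have e4 := sq_pow k0.
have s0 : 0 < 2 ^ k.-1 by rewrite expn_gt0.
elim: p I => [|p IH] I.
  rewrite expn0 big_cons big_nil => hI _; have [cI bI] := hI 0 isT.
  case: (I 0) cI bI => // i u /andP[/= /andP[+ _] _] /(_ i (mem_head _ _)).
  lia.
set t := 4 ^ k in IH e4 *; set N := t ^ p in IH *.
have t0 : 0 < t by rewrite expn_gt0.
rewrite expnSr -/N => hI nm.
have [L1 [hI1 nm1 h1]] := merge_items k0 hI nm.
have [L2 [A [hI2 nm2 nmA h2]]] := contract_items t0 hI1 nm1.
have h3 := IH _ hI2 nm2.
have h4 := ones_minor_free k0 nmA.
move: h1 h2 h3 h4; rewrite -/t -/N.
move: (\sum_(_ <- _) _) (\sum_(_ <- _) _) (\sum_(_ <- _) _) (ones_in _ _ _ _) => c b a d.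
clear - e4 s0 t0; clearbody N; clearbody t.
move: (2 ^ k.-1) (k * 16 ^ k) e4 s0 => s f e4 s0 h1 h2 h3 h4.
have h5 : t * d <= t * (4 * (s * f) * N) by rewrite leq_mul2l h4 orbT.
have h6 : s * b <= s * (c + t * d) by rewrite leq_mul2l h2 orbT.
set D := s * (4 * (s * f)) + 2 * f in h3 *.
have h7 : s * c <= s * (2 * D * N) by rewrite leq_mul2l h3 orbT.
have h8 : s * (2 * D * N) <= t * (D * N).
  have : 2 * s <= t by nia.
  move=> /(leq_mul (leqnn (D * N))); lia.
have h9 : s * (t * d) <= s * (t * (4 * (s * f) * N)) by rewrite leq_mul2l h5 orbT.
have h10 : s * (t * (4 * (s * f) * N)) + 2 * f * (N * t) = t * (D * N) by rewrite /D; lia.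
rewrite mulnDr in h6; lia.
Qed.

Lemma pow_above t x : 1 < t -> exists2 p, x <= t ^ p & t ^ p <= t * x.+1.
Proof.
move=> t1; elim: x => [|x [p h1 h2]]; first by exists 0; rewrite // muln1 ltnW.
have [h|h] := leqP x.+1 (t ^ p).
  by exists p => //; apply: leq_trans h2 _; rewrite leq_mul2l leqnSn orbT.
have -> : x = t ^ p by lia.
by exists p.+1; rewrite expnS ?leq_mul2l ?leqW ?orbT // (ltn_Pmull t1) // expn_gt0 ltnW.
Qed.

Lemma items_minor_free k I n m : 0 < k -> items_in I n m ->
  ~ has_minor k k (item_box I m) ->
  \sum_(q <- iota 0 m) size (I q) <= 2 ^ (14 * k) * (n + m).
Proof.
move=> k0 hI nm; have [->|m0] := posnP m; first by rewrite big_nil.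
have [p h1 h2] : exists2 p, maxn n m <= (4 ^ k) ^ p & (4 ^ k) ^ p <= 4 ^ k * (maxn n m).+1.
  by apply: pow_above; rewrite (ltn_exp2l 0).
set N := (4 ^ k) ^ p in h1 h2.
pose J q := if q < m then I q else [::].
have hJ : items_in J N N.
  rewrite /J => q _; case: ifP => // /hI[cI bI]; split=> // i /bI; lia.
have nJ : ~ has_minor k k (item_box J N).
  move=> h; apply: nm; apply: sub_minor h => x y u v [q [i [_ quv + ins]]].
  by rewrite /J; case: ifP => // qm iI; exists q, i.
have := items_minor_free_pow k0 hJ nJ; rewrite -/N => h3.
have -> : \sum_(q <- iota 0 m) size (I q) = \sum_(q <- iota 0 m) size (J q).
  rewrite big_seq [RHS]big_seq; apply: eq_bigr => q; rewrite mem_iota /J add0n.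
  by move=> /andP[_ ->].
apply: leq_trans (_ : _ <= \sum_(q <- iota 0 N) size (J q)) _.
  have -> : N = m + (N - m) by lia.
  by rewrite iotaD big_cat leq_addr.
apply: leq_trans h3 _.
have := sq_pow k0; set s := 2 ^ k.-1 => e4.
have kk : k <= 2 ^ k by rewrite ltnW // ltn_expl.
have e16 : 16 ^ k = 2 ^ k * 2 ^ k * (2 ^ k * 2 ^ k) by rewrite -!expnMn.
have e4' : 4 ^ k = 2 ^ k * 2 ^ k by rewrite -!expnMn.
have e14 : 2 ^ (14 * k) = (2 ^ k) ^ 14 by rewrite mulnC expnM.
have g2 : 2 <= 2 ^ k by rewrite (leq_exp2l 1).
rewrite e14; rewrite e4' in e4 h2; rewrite e16.
clear - kk e4 g2 h2 m0; clearbody s N; move: (2 ^ k) kk e4 g2 h2 => x kx e4 x2 h2.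
have hf : k * (x * x * (x * x)) <= x ^ 5 by rewrite -[x ^ 5]/(x * (x * (x * (x * x)))); nia.
have hN : N <= x ^ 2 * (2 * (n + m)).
  by apply: leq_trans h2 _; rewrite -[x ^ 2]/(x * x) leq_mul2l; apply/orP; right; lia.
move: (k * _) hf => f hf.
have -> : s * (4 * (s * f)) = x * x * f by rewrite -e4; lia.
have : 2 * (x * x * f + 2 * f) <= 4 * (x ^ 2 * x ^ 5).
  have : 2 <= x * x by nia.
  rewrite -[x ^ 2]/(x * x) => /(leq_mul (leqnn f)).
  have := leq_mul (leqnn (x * x)) hf; lia.
move=> /(leq_mul hN) h; rewrite mulnC; apply: leq_trans h _.
(* The exponent 14 is generous: with [x = 2 ^ k] the constant found is [8 * x ^ 9], and
   [8 <= 2 ^ 5 <= x ^ 5]. *)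
have -> : x ^ 2 * (2 * (n + m)) * (4 * (x ^ 2 * x ^ 5)) = 8 * (x ^ 9 * (n + m)).
  rewrite (_ : x ^ 9 = x ^ 2 * (x ^ 2 * x ^ 5)) -?expnD //; lia.
have -> : x ^ 14 = x ^ 5 * x ^ 9 by rewrite -expnD.
rewrite -mulnA leq_mul2r; apply/orP; right.
apply: leq_trans (_ : 2 ^ 5 <= _) => //; rewrite leq_exp2r //.
Qed.

(** * Light patterns and hats *)

(** The row map [r] is fixed from outside, so that partial embeddings with the same rows can be
    concatenated; only the columns are searched for. *)
Fixpoint embeds (A : nat -> nat -> bool) (r : nat -> nat) (W : seq nat) (a b : nat) : Prop :=
  if W is p :: W' then
    exists c, [/\ a <= c, c < b, A (r p) c & embeds A r W' c.+1 b]
  else True.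

(* W lists, column by column, the row of the unique 1 of a pattern with K rows. *)
Definition occurs (K : nat) (W : seq nat) A (X : seq nat) (a b : nat) : Prop :=
  exists r : nat -> nat,
    [/\ forall i j, i < j -> j < K -> r i < r j,
        forall i, i < K -> r i \in X & embeds A r W a b].

Lemma embeds_widen A r W a b a' b' : a' <= a -> b <= b' ->
  embeds A r W a b -> embeds A r W a' b'.
Proof.
elim: W a a' => [//|p W IH] a a' aa bb /= [c [h1 h2 h3 h4]].
by exists c; split=> //; [exact: leq_trans h1|exact: leq_trans bb|exact: IH h4].
Qed.

Lemma embeds_cat A r W V a b c : a <= b -> b <= c -> embeds A r W a b -> embeds A r V b c ->
  embeds A r (W ++ V) a c.
Proof.
move=> ab bc; elim: W a ab => [|p W IH] a ab /=.
  by move=> _; exact: embeds_widen.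
move=> [x [h1 h2 h3 h4]] hV; exists x; split=> //; first exact: leq_trans bc.
exact: IH.
Qed.

Lemma embeds_catl A r W V a b : embeds A r (W ++ V) a b -> embeds A r W a b.
Proof. by elim: W a => [//|p W IH] a [c [? ? ? /IH ?]]; exists c. Qed.

Lemma embeds_catr A r W V a b : embeds A r (W ++ V) a b -> embeds A r V a b.
Proof.
elim: W a => [//|p W IH] a [c [ac _ _ /IH]]; apply: embeds_widen => //; exact: leqW.
Qed.

(** With a single 1 per column, each merged column only has to supply one original column, and the
    order is kept. *)
Lemma embeds_merge A r W (cut : nat -> nat) q q' : {homo cut : i j / i <= j} ->
  embeds (merge_cols A cut) r W q q' -> embeds A r W (cut q) (cut q').
Proof.
move=> hc; elim: W q => [//|p W IH] q [x [h1 h2 /hasP[c]]].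
rewrite mem_index_iota => /andP[c1 c2] Ac /IH h; exists c; split=> //.
- exact: leq_trans (hc _ _ h1) c1.
- exact: leq_trans c2 (hc _ _ h2).
- by apply: embeds_widen h.
Qed.

Lemma occurs_sub K W A X X' a b a' b' : {subset X <= X'} -> a' <= a -> b <= b' ->
  occurs K W A X a b -> occurs K W A X' a' b'.
Proof.
move=> sX aa bb [r [h1 h2 h3]]; exists r; split=> //; first by move=> i /h2/sX.
exact: embeds_widen h3.
Qed.

Lemma count_le1 (T : eqType) (P : pred T) s : uniq s ->
  (forall x y, x \in s -> y \in s -> P x -> P y -> x = y) -> count P s <= 1.
Proof.
move=> us h; rewrite -size_filter.
have : uniq (filter P s) by exact: filter_uniq.
have : {subset filter P s <= [pred x | (x \in s) && P x]}.
  by move=> x; rewrite mem_filter inE andbC.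
case: filter => [|x [|y u]] //= hs /andP[].
have /andP[xs Px] := hs x (mem_head _ _).
have /andP[ys Py] : (y \in s) && P y by apply: hs; rewrite !inE eqxx orbT.
by rewrite (h x y) // mem_head.
Qed.

(* r p = u and r q = v code the rows u < v of the hat inside embeds. *)
Definition hat_in A (X : seq nat) (a b : nat) : Prop :=
  exists u v, [/\ u \in X, v \in X, u < v &
    forall r p q, r p = u -> r q = v -> embeds A r [:: q; p; q] a b].

(** Discard the first and the last 1 of each row. Two remaining 1s in one column would form a hat:
    the upper one is its top, and the lower row has 1s on both sides. So at most one remains per
    column. *)
Lemma hat_free_ones A (X : seq nat) a b : uniq X -> ~ hat_in A X a b ->
  ones_in A X a b <= 2 * size X + (b - a).
Proof.
move=> uX nh.
pose bef r c := has (A r) (index_iota a c).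
pose aft r c := has (A r) (index_iota c.+1 b).
have row r : count (A r) (index_iota a b) <=
    2 + count (fun c => [&& A r c, bef r c & aft r c]) (index_iota a b).
  apply: leq_trans (_ : _ <= count (fun c => A r c && ~~ bef r c) (index_iota a b) +
     count (fun c => A r c && ~~ aft r c) (index_iota a b) +
     count (fun c => [&& A r c, bef r c & aft r c]) (index_iota a b)) _.
    elim: index_iota => //= c s IH.
    case: (A r c); case: (bef r c); case: (aft r c) => /=; lia.
  rewrite leq_add2r -[2]/(1 + 1); apply: leq_add; apply: count_le1; rewrite ?iota_uniq //.
    move=> x y; rewrite !mem_index_iota => xs ys /andP[Ax nx] /andP[Ay ny].
    case: (ltngtP x y) => // lt.
      case/negP: ny; apply/hasP; exists x => //; rewrite mem_index_iota; lia.
    case/negP: nx; apply/hasP; exists y => //; rewrite mem_index_iota; lia.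
  move=> x y; rewrite !mem_index_iota => xs ys /andP[Ax nx] /andP[Ay ny].
  case: (ltngtP x y) => // lt.
    case/negP: nx; apply/hasP; exists y => //; rewrite mem_index_iota; lia.
  case/negP: ny; apply/hasP; exists x => //; rewrite mem_index_iota; lia.
apply: leq_trans (_ : _ <= \sum_(r <- X) (2 + count (fun c => [&& A r c, bef r c & aft r c]) (index_iota a b))) _.
  by apply: leq_sum => r _.
rewrite big_split /= sum_const_seq mulnC leq_add2l.
under eq_bigr do rewrite count_sum.
rewrite exchange_big /=; apply: leq_trans (_ : _ <= \sum_(c <- index_iota a b) 1) _; last first.
  by rewrite sum_const_seq muln1 size_iota.
apply: leq_sum => c _; rewrite -(count_sum (fun r => [&& A r c, bef r c & aft r c])).
apply: count_le1 => // x y xX yX /and3P[Ax bx ax] /and3P[Ay By ay].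
wlog lt : x y xX yX Ax bx ax Ay By ay / x < y => [W|].
  by case: (ltngtP x y) => // lt; [|symmetry]; apply: W.
case: nh; exists x, y; split=> // r p q rp rq /=.
have /hasP[c1] := By; rewrite mem_index_iota => c1s A1.
have /hasP[c2] := ay; rewrite mem_index_iota => c2s A2.
have [h1 h2 h3] : [/\ a <= c1, c1 < b & c1 < c] by clear - c1s c2s; split; lia.
have [h4 h5 h6] : [/\ c < b, c < c2 & c2 < b] by clear - c1s c2s; split; lia.
exists c1; split; rewrite ?rq //; exists c; split; rewrite ?rp //.
by exists c2; split; rewrite ?rq.
Qed.

Lemma ones_in_cat A X Y a b : ones_in A (X ++ Y) a b = ones_in A X a b + ones_in A Y a b.
Proof. exact: big_cat. Qed.

(* H collects the row groups on which a hat closes; apart from them the rows split into at most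
   (size I).+1 hat-free intervals. *)
Lemma slab_bound A (grp : nat -> nat) G (X : seq nat) a b gamma : uniq X ->
  (forall g, count (fun r => grp r == g) X <= G) ->
  (forall r, r \in X -> grp r < gamma) ->
  exists I (H : seq nat), [/\ chain I /\ (forall i, i \in I -> i.2 <= gamma),
    forall i, i \in I -> hat_in A [seq r <- X | i.1 <= grp r < i.2] a b,
    uniq H /\ {subset H <= X}, size H <= G * size I &
    ones_in A X a b <= 2 * size X + (b - a) * (size I).+1 + ones_in A H a b].
Proof.
move=> uX hG hX.
pose below z := [seq r <- X | grp r < z].
pose btw y z := [seq r <- X | y <= grp r < z].
have splitb y z : y <= z -> perm_eq (below z) (below y ++ btw y z).
  move=> yz; rewrite /below /btw.
  have e1 : [seq r <- X | grp r < y] = filter (fun r => grp r < y) (below z).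
    rewrite -filter_predI; apply: eq_filter => r /=; lia.
  have e2 : [seq r <- X | y <= grp r < z] = filter (predC (fun r => grp r < y)) (below z).
    rewrite -filter_predI; apply: eq_filter => r /=; lia.
  by rewrite e1 e2 perm_sym perm_filterC.
have onesb y z : y <= z -> ones_in A (below z) a b = ones_in A (below y) a b + ones_in A (btw y z) a b.
  by move=> yz; rewrite -ones_in_cat /ones_in; apply: perm_big; exact: splitb.
have sizeb y z : y <= z -> size (below z) = size (below y) + size (btw y z).
  by move=> yz; rewrite -size_cat; apply: perm_size; exact: splitb.
(* Greedy scan over the groups: [z] is where the current hat-free interval begins. *)
suff [I [H [z [zg [[cI bI] hI [uH sH] GH [oH nh]]]]]] : exists I (H : seq nat) z, z <= gamma /\
   [/\ chain I /\ (forall i, i \in I -> i.2 <= z),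
    forall i, i \in I -> hat_in A (btw i.1 i.2) a b,
    uniq H /\ {subset H <= below z}, size H <= G * size I &
    ones_in A (below z) a b <= 2 * size (below z) + (b - a) * size I + ones_in A H a b
    /\ ~ hat_in A (btw z gamma) a b].
  have eX : X = below gamma.
    by apply/esym/all_filterP/allP => r /hX.
  exists I, H; split=> //.
  - by split=> // i /bI h; exact: leq_trans zg.
  - by split=> // r /sH; rewrite mem_filter => /andP[].
  rewrite eX (onesb z) // (sizeb z) // mulnS.
  have := hat_free_ones (filter_uniq _ uX) nh; rewrite -/(btw z gamma); move: (b - a) (size I) oH => w sI; lia.
have nbtw z : ~ hat_in A (btw z z) a b.
  by move=> [u [v []]]; rewrite mem_filter => /andP[/andP[h1 h2] _]; lia.
have below0 : below 0 = [::] by apply/eqP; rewrite -(negbK (_ == _)) -has_filter; apply/hasPn => r.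
elim: {hX}gamma => [|g [I [H [z [zg [[cI bI] hI [uH sH] GH [oH nh]]]]]]].
  exists [::], [::], 0; split=> //; split=> //.
  by rewrite below0 /ones_in !big_nil; split=> //; exact: nbtw.
have [ht|nht] := pselect (hat_in A (btw z g.+1) a b); last first.
  by exists I, H, z; split; [exact: leqW|].
(* Group [g] closes a hat: the item [(z, g.+1)] is recorded, the rows of the group go to [H], and a
   new interval begins at [g.+1]. *)
pose Xg := [seq r <- X | grp r == g].
have eXg : btw g g.+1 = Xg by apply: eq_filter => r; lia.
exists (rcons I (z, g.+1)), (H ++ Xg), g.+1; split=> //; split.
- split; last by move=> i; rewrite mem_rcons inE => /orP[/eqP-> //|/bI]; lia.
  have /andP[h1 h2] := cI; rewrite /chain all_rcons h1 pairwise_rcons h2 /= ltnS zg /= andbT.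
  exact/allP.
- by move=> i; rewrite mem_rcons inE => /orP[/eqP-> //|/hI].
- split.
    rewrite cat_uniq uH filter_uniq // andbT /=; apply/hasPn => r.
    rewrite mem_filter => /andP[/eqP gr _]; apply/negP => /sH.
    rewrite mem_filter => /andP[]; lia.
  move=> r; rewrite mem_cat => /orP[/sH|]; rewrite !mem_filter => /andP[h ->]; rewrite andbT; lia.
- rewrite size_cat size_rcons mulnS size_filter addnC; exact: leq_add.
split; last exact: nbtw.
rewrite (onesb g) // (sizeb g) // (onesb z) // (sizeb z) // ones_in_cat eXg size_rcons mulnS.
have := hat_free_ones (filter_uniq _ uX) nh; rewrite -/(btw z g); move: (b - a) (size I) oH => w sI; lia.
Qed.

(** [sigma j] is the row of the 1 in column [j], so [sigma] codes the inverse of the permutation.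
    Each hat reads bottom, top, bottom. *)
Definition hats (sigma : nat -> nat) (k : nat) : seq nat :=
  flatten [seq [:: (sigma j).*2.+1; (sigma j).*2; (sigma j).*2.+1] | j <- iota 0 k].

Lemma hatsS sigma k : hats sigma k.+1 =
  hats sigma k ++ [:: (sigma k).*2.+1; (sigma k).*2; (sigma k).*2.+1].
Proof. by rewrite /hats -addn1 iotaD map_cat flatten_cat. Qed.

Lemma size_hats sigma k : size (hats sigma k) = 3 * k.
Proof. by elim: k => // k IH; rewrite hatsS size_cat IH /=; lia. Qed.

(** From block [(i, tau i)] of the grid take the hat of an item in it. Distinct [i] use disjoint,
    increasing ranges of row groups, and distinct [j] use disjoint, increasing ranges of slabs, so
    these [k] hats assemble into the whole pattern. *)
Lemma minor_hats k (sigma tau : nat -> nat) A (X : seq nat) (grp cut : nat -> nat) m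
    (F : nat -> seq nat) I :
  (forall i, i < k -> tau i < k /\ sigma (tau i) = i) ->
  (forall j, j < k -> sigma j < k /\ tau (sigma j) = j) ->
  {homo grp : i j / i <= j} -> {homo cut : i j / i <= j} ->
  (forall q, {subset F q <= X}) ->
  (forall q i, q < m -> i \in I q ->
     hat_in A [seq r <- F q | i.1 <= grp r < i.2] (cut q) (cut q.+1)) ->
  has_minor k k (item_box I m) ->
  occurs k.*2 (hats sigma k) A X (cut 0) (cut m).
Proof.
move=> tauP sigP hg hc FX hI [rho [kap [hr hk hB]]].
have hf i : exists uvq : nat * nat * nat, i < k ->
    let: (u, v, q) := uvq in
    [/\ u \in X /\ v \in X, u < v, rho i <= grp u /\ grp v < rho i.+1,
        q < m /\ kap (tau i) <= q < kap (tau i).+1 &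
        forall r p q', r p = u -> r q' = v ->
          embeds A r [:: q'; p; q'] (cut q) (cut q.+1)].
  have [ik|] := ltnP i k; last by exists (0, 0, 0).
  have [q [it [qm qk itI /andP[i1 i2]]]] := hB i (tau i) ik (tauP i ik).1.
  have [u [v [+ + uv huv]]] := hI q it qm itI.
  rewrite !mem_filter => /andP[/andP[u1 u2] uF] /andP[/andP[v1 v2] vF].
  exists (u, v, q) => _; split=> //; first by split; exact: (FX q).
  by split; lia.
have [f fP] := choice hf.
pose r n := if odd n then (f n./2).1.2 else (f n./2).1.1.
have half n : n < k.*2 -> n./2 < k by lia.
have rP n : n < k.*2 -> r n \in X /\ rho n./2 <= grp (r n) < rho (n./2).+1.
  move=> /half nk; have := fP _ nk; rewrite /r.
  case: (f n./2) => [[u v] q] /= [[uX vX] uv [h1 h2] _ _].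
  have := hg _ _ (ltnW uv); case: ifP; split=> //; lia.
exists r; split=> [i j ij jk|i /rP[]//|].
  have [e|ne] := eqVneq i./2 j./2.
    have [oi oj] : odd i = false /\ odd j = true by lia.
    have := fP _ (half _ jk); rewrite /r oi oj e.
    by case: (f j./2) => [[u v] q] /= [].
  have /rP[_ hi] : i < k.*2 by lia.
  have /rP[_ hj] := jk.
  have /hr : (i./2).+1 <= j./2 by lia.
  rewrite ltnNge => h; apply/negP => /hg; lia.
(* [kap j] may exceed the number of slabs, hence the truncation at [m]. *)
suff H j : j <= k -> embeds A r (hats sigma j) (cut 0) (cut (minn (kap j) m)).
  by apply: embeds_widen (H k (leqnn k)) => //; apply: hc; exact: geq_minr.
elim: j => // j IH jk; rewrite hatsS.
have [sk ts] := sigP j jk.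
have := fP _ sk; rewrite ts; case E: (f (sigma j)) => [[u v] q] [_ _ _ [qm qj] he].
apply: (embeds_cat (b := cut (minn (kap j) m))).
- exact: hc.
- by apply: hc; have := hk _ _ (leqnSn j); lia.
- exact: IH (ltnW jk).
apply: embeds_widen (he r (sigma j).*2 (sigma j).*2.+1 _ _); try (apply: hc; lia).
  by rewrite /r odd_double doubleK E.
by rewrite /r /= odd_double /= uphalf_double E.
Qed.

(** By [minor_hats] the items recorded by [slab_bound] in all slabs have no [k] by [k] minor, so
    [items_minor_free] bounds their number. Each item costs one slab width and one group of at most
    [G] rows. Item ends range up to [gamma] inclusive, hence [gamma.+1]. *)
Lemma middle_bound k (sigma tau : nat -> nat) A (X : seq nat) (grp cut : nat -> nat)
    gamma G w m (F : nat -> seq nat) : 0 < k ->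
  (forall i, i < k -> tau i < k /\ sigma (tau i) = i) ->
  (forall j, j < k -> sigma j < k /\ tau (sigma j) = j) ->
  {homo grp : i j / i <= j} -> {homo cut : i j / i <= j} ->
  (forall q, uniq (F q) /\ {subset F q <= X}) ->
  (forall g, count (fun r => grp r == g) X <= G) ->
  (forall r, r \in X -> grp r < gamma) ->
  (forall q, q < m -> cut q.+1 - cut q <= w) ->
  ~ occurs k.*2 (hats sigma k) A X (cut 0) (cut m) ->
  exists H : nat -> seq nat,
    [/\ forall q, uniq (H q) /\ {subset H q <= F q},
        \sum_(q <- iota 0 m) size (H q) <= G * (2 ^ (14 * k) * (gamma.+1 + m)) &
        \sum_(q <- iota 0 m) ones_in A (F q) (cut q) (cut q.+1) <=
        2 * (\sum_(q <- iota 0 m) size (F q)) + w * (m + 2 ^ (14 * k) * (gamma.+1 + m))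
        + \sum_(q <- iota 0 m) ones_in A (H q) (cut q) (cut q.+1)].
Proof.
move=> k0 tauP sigP hg hc hF hG hgam hw nocc.
have hq q : exists IH : seq (nat * nat) * seq nat,
    [/\ chain IH.1 /\ (forall i, i \in IH.1 -> i.2 <= gamma),
    forall i, i \in IH.1 -> hat_in A [seq r <- F q | i.1 <= grp r < i.2] (cut q) (cut q.+1),
    uniq IH.2 /\ {subset IH.2 <= F q}, size IH.2 <= G * size IH.1 &
    ones_in A (F q) (cut q) (cut q.+1) <=
    2 * size (F q) + (cut q.+1 - cut q) * (size IH.1).+1 + ones_in A IH.2 (cut q) (cut q.+1)].
  have [uF FX] := hF q.
  have [|r /FX/hgam //|I [H h]] := @slab_bound A grp G (F q) (cut q) (cut q.+1) gamma uF.
    move=> g; apply: leq_trans (hG g); rewrite -!size_filter; apply: uniq_leq_size.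
      exact: filter_uniq.
    by move=> r; rewrite !mem_filter => /andP[-> /FX].
  by exists (I, H).
have [IH hIH] := choice hq.
have tot : \sum_(q <- iota 0 m) size (IH q).1 <= 2 ^ (14 * k) * (gamma.+1 + m).
  apply: items_minor_free => // [q qm|hm].
    by have [[cI bI] _ _ _ _] := hIH q; split=> // i /bI; rewrite ltnS.
  apply: nocc; apply: (minor_hats tauP sigP hg hc (F := F)) hm.
    by move=> q; have [] := hF q.
  by move=> q i _; have [_ h _ _ _] := hIH q; exact: h.
exists (fun q => (IH q).2); split=> [q||].
- by have [] := hIH q.
- apply: leq_trans (_ : _ <= \sum_(q <- iota 0 m) G * size (IH q).1) _.
    by apply: leq_sum => q _; have [] := hIH q.
  by rewrite -big_distrr leq_mul2l tot orbT.
apply: leq_trans (_ : _ <= \sum_(q <- iota 0 m)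
    (2 * size (F q) + w * (size (IH q).1).+1 + ones_in A (IH q).2 (cut q) (cut q.+1))) _.
  rewrite big_seq [leqRHS]big_seq; apply: leq_sum => q; rewrite mem_iota => /hw cw.
  have [_ _ _ _ h] := hIH q; apply: leq_trans h _.
  by rewrite leq_add2r leq_add2l leq_mul2r cw orbT.
rewrite 2!big_split /= leq_add2r; apply: leq_add; rewrite -big_distrr //= leq_mul2l.
apply/orP; right; under eq_bigr do rewrite -addn1.
by rewrite big_split /= sum_const_seq size_iota muln1 addnC leq_add2l.
Qed.

(** Dividing ranks, rather than row indices, cuts [X] into groups of equal size whatever its gaps
    are. *)
Definition rank (X : seq nat) (r : nat) : nat := count (fun x => x < r) X.

Lemma rank_homo X : {homo rank X : i j / i <= j}.
Proof. by move=> i j ij; apply: sub_count => x /= /leq_trans; exact. Qed.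

Lemma rank_ltn X r : r \in X -> rank X r < size X.
Proof.
move=> rX; rewrite /rank -(count_predC (fun x => x < r) X) -addn1 leq_add2l -has_count.
by apply/hasP; exists r => //=; rewrite ltnn.
Qed.

Lemma rank_inj X x y : x \in X -> x < y -> rank X x < rank X y.
Proof.
move=> xX xy; rewrite /rank -!size_filter.
have -> : [seq z <- X | z < x] = [seq z <- [seq z <- X | z < y] | z < x].
  by rewrite -filter_predI; apply: eq_filter => z /=; lia.
rewrite size_filter -(count_predC (fun x0 => x0 < x) [seq z <- X | z < y]) -addn1 leq_add2l.
by rewrite -has_count; apply/hasP; exists x; rewrite /= ?mem_filter ?xy ?ltnn.
Qed.

Lemma rank_group X G g : uniq X -> 0 < G ->
  count (fun r => rank X r %/ G == g) X <= G.
Proof.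
move=> uX G0; rewrite -size_filter -(size_map (rank X)) -[leqRHS](size_iota (g * G)).
apply: uniq_leq_size => [|_ /mapP[r + ->]].
  rewrite map_inj_in_uniq ?filter_uniq // => x y; rewrite !mem_filter => /andP[_ xX] /andP[_ yX] e.
  by case: (ltngtP x y) => // [/(rank_inj xX)|/(rank_inj yX)]; rewrite e ltnn.
rewrite mem_filter mem_iota => /andP[/eqP <- _].
by rewrite leq_divM /= [X in _ < X]addnC -mulSn ltn_ceil.
Qed.

(** * The Ackermann recursion *)

(** [x] is the price of a row, [y] that of a column, and [M] caps the width. Uniformity in [A] and
    [X] lets the bound be applied to slabs, to subsets of rows and to merged matrices. *)
Definition light_bound (K : nat) (W : seq nat) (x y M : nat) : Prop :=
  forall A (X : seq nat) a m, uniq X -> m <= M -> ~ occurs K W A X a (a + m) ->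
    ones_in A X a (a + m) <= x * size X + y * m.

Lemma light_bound_weaken K W x y M x' y' M' : x <= x' -> y <= y' -> M' <= M ->
  light_bound K W x y M -> light_bound K W x' y' M'.
Proof.
move=> xx yy MM h A X a m uX mM nocc.
apply: leq_trans (h A X a m uX (leq_trans mM MM) nocc) _.
by apply: leq_add; rewrite leq_mul2r ?xx ?yy orbT.
Qed.

(** The last 1 comes for free: whichever row plays [q], it has a 1 further right. *)
Lemma occurs_rcons K V q A (Y : seq nat) a b c : a <= b -> b <= c -> q < K ->
  (forall r, r \in Y -> has (A r) (index_iota b c)) ->
  occurs K V A Y a b -> occurs K (rcons V q) A Y a c.
Proof.
move=> ab bc qK hY [r [h1 h2 h3]]; exists r; split=> //; rewrite -cats1.
apply: embeds_cat h3 _ => //=; have /hY/hasP[x] := h2 q qK.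
by rewrite mem_index_iota => /andP[? ?] ?; exists x.
Qed.

Lemma occurs_cons K V p A (Y : seq nat) a b c : a <= b -> b <= c -> p < K ->
  (forall r, r \in Y -> has (A r) (index_iota a b)) ->
  occurs K V A Y b c -> occurs K (p :: V) A Y a c.
Proof.
move=> ab bc pK hY [r [h1 h2 h3]]; exists r; split=> //=.
have /hY/hasP[x] := h2 p pK; rewrite mem_index_iota => /andP[ax xb] Ax.
exists x; split=> //; first exact: leq_trans bc.
exact: embeds_widen h3.
Qed.

Lemma ones_in_filter A (P : pred nat) X a b :
  ones_in A (filter P X) a b = \sum_(r <- X) P r * count (A r) (index_iota a b).
Proof.
rewrite /ones_in big_filter big_mkcond; apply: eq_bigr => r _.
by case: (P r); rewrite ?mul1n.
Qed.

Lemma sum_size_filter (P : nat -> pred nat) (X : seq nat) m :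
  \sum_(q <- iota 0 m) size [seq r <- X | P q r] =
  \sum_(r <- X) count (P^~ r) (iota 0 m).
Proof.
under eq_bigr do rewrite size_filter count_sum.
by rewrite exchange_big; apply: eq_bigr => r _; rewrite count_sum.
Qed.

(** One step of the recursion, with slabs of width [s]. [(x, y)] serves rows confined to a slab,
    [(x1, y1)] the merged matrix, [(x2, y2)] first and last slabs, where [W] loses one end, and
    [(x3, y3)] the groups on which hats close, where it loses both. The 2 before [x1] comes from
    [hat_free_ones]. *)
Lemma light_bound_step k (sigma tau : nat -> nat) L R p q V s Mc x y x1 y1 x2 y2 x3 y3 Y :
  0 < k ->
  (forall i, i < k -> tau i < k /\ sigma (tau i) = i) ->
  (forall j, j < k -> sigma j < k /\ tau (sigma j) = j) ->
  hats sigma k = L ++ (p :: rcons V q) ++ R -> p < k.*2 -> q < k.*2 -> 0 < s ->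
  light_bound k.*2 (p :: rcons V q) x y s ->
  light_bound k.*2 (p :: rcons V q) x1 y1 Mc ->
  light_bound k.*2 (p :: V) x2 y2 s ->
  light_bound k.*2 (rcons V q) x2 y2 s ->
  light_bound k.*2 V x3 y3 s ->
  y1 <= Y * s ->
  2 * x1 + 2 * x2 + 2 ^ (14 * k) * (1 + x3) <= x ->
  light_bound k.*2 (p :: rcons V q) x
    (y + 2 * y2 + y3 + 2 + 2 ^ (14 * k) * 4 * (1 + x3) + 4 * Y) (s * Mc).
Proof.
move=> k0 tauP sigP eW pK qK s0 bW bW1 bWl bWr bV yY hx A X a m uX mM nocc.
set W := p :: rcons V q in eW bW bW1 nocc.
set C := 2 ^ (14 * k) in hx *.
have [ms|sm] := leqP m s.
  apply: leq_trans (bW A X a m uX ms nocc) _; rewrite leq_add2l leq_mul2r.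
  by apply/orP; right; rewrite -!addnA leq_addr.
pose m' := (m + s.-1) %/ s.
have m's : m <= m' * s <= 2 * m.
  have := leq_divM (m + s.-1) s; have := ltn_ceil (m + s.-1) s0; rewrite -/m'; lia.
have m'M : m' <= Mc.
  by rewrite -ltnS ltn_divLR // mulSn; move: mM; rewrite mulnC; lia.
pose cut i := a + minn (i * s) m.
have cut0 : cut 0 = a by rewrite /cut mul0n min0n addn0.
have cutm : cut m' = a + m by rewrite /cut (minn_idPr _) //; case/andP: m's.
have hc : {homo cut : i j / i <= j}.
  by move=> i j ij; have : i * s <= j * s by [rewrite leq_mul2r ij orbT]; rewrite /cut; lia.
have cutS i : cut i.+1 = cut i + (cut i.+1 - cut i) by rewrite subnKC // hc.
have cutw i : cut i.+1 - cut i <= s by rewrite /cut mulSn; lia.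
have sumw : \sum_(i <- iota 0 m') (cut i.+1 - cut i) = m.
  have := count_cuts predT m' hc; rewrite count_predT size_iota cut0 cutm addKn => ->.
  by apply: eq_bigr => i _; rewrite count_predT size_iota.
have sumB (F : nat -> seq nat) u v : (forall i, i < m' ->
    ones_in A (F i) (cut i) (cut i.+1) <= u * size (F i) + v * (cut i.+1 - cut i)) ->
    \sum_(i <- iota 0 m') ones_in A (F i) (cut i) (cut i.+1) <=
    u * (\sum_(i <- iota 0 m') size (F i)) + v * m.
  move=> h; rewrite -[in v * m]sumw !big_distrr -big_split /=.
  by rewrite big_seq [leqRHS]big_seq; apply: leq_sum => i; rewrite mem_iota => /h.
pose nz r i := merge_cols A cut r i.
pose bef r i := has (A r) (index_iota a (cut i)).
pose aft r i := has (A r) (index_iota (cut i.+1) (a + m)).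
(* The flags tell whether row [r] has 1s before and after slab [i]: [false false] is a local row,
   [false true] a first slab, [true false] a last slab and [true true] a middle slab. *)
pose cls b1 b2 i r := [&& nz r i, bef r i == b1 & aft r i == b2].
pose F b1 b2 i := [seq r <- X | cls b1 b2 i r].
have uF b1 b2 i : uniq (F b1 b2 i) by exact: filter_uniq.
have FX b1 b2 i : {subset F b1 b2 i <= X} by move=> r; rewrite mem_filter => /andP[].
have Fb b2 i r : r \in F true b2 i -> has (A r) (index_iota a (cut i)).
  by rewrite mem_filter => /andP[/and3P[_ /eqP]].
have Fa b1 i r : r \in F b1 true i -> has (A r) (index_iota (cut i.+1) (a + m)).
  by rewrite mem_filter => /andP[/and3P[_ _ /eqP]].
have ca i : a <= cut i by rewrite -cut0 hc.
have cm i : cut i <= a + m by rewrite /cut leq_add2l geq_minr.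
have split4 i : ones_in A X (cut i) (cut i.+1) =
    ones_in A (F false false i) (cut i) (cut i.+1) + ones_in A (F false true i) (cut i) (cut i.+1)
    + ones_in A (F true false i) (cut i) (cut i.+1) + ones_in A (F true true i) (cut i) (cut i.+1).
  rewrite !ones_in_filter -!big_split /=; apply: eq_bigr => r _.
  rewrite /cls /nz /merge_cols has_count; case: ltnP => [_|]; last by rewrite leqn0 => /eqP->; rewrite !muln0.
  by case: (bef r i); case: (aft r i); rewrite /= ?mul1n ?mul0n ?addn0.
have nzbef r i j : i < j -> nz r i -> bef r j.
  move=> ij /hasP[c]; rewrite mem_index_iota => cc Ac; apply/hasP; exists c => //.
  rewrite mem_index_iota; have := hc _ _ ij; have := ca i; lia.
have nzaft r i j : i < j -> nz r j -> aft r i.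
  move=> ij /hasP[c]; rewrite mem_index_iota => cc Ac; apply/hasP; exists c => //.
  rewrite mem_index_iota; have := hc _ _ ij; have := cm j.+1; lia.
(* Rows meeting at least two slabs. Such a row has at most one first and one last slab and is never
   local, so local rows and the [n0] global ones share the budget [size X]. *)
pose glob r := has (fun i => nz r i && (bef r i || aft r i)) (iota 0 m').
pose X0 := [seq r <- X | glob r].
have cls1 b1 b2 r : ~~ (b1 && b2) -> count ((cls b1 b2)^~ r) (iota 0 m') <= 1.
  move=> nb; apply: count_le1; first exact: iota_uniq.
  move=> i j _ _ /and3P[zi /eqP bi /eqP ai] /and3P[zj /eqP bj /eqP aj].
  case: (ltngtP i j) => // lt.
    by move: nb; rewrite -bj -ai (nzbef _ _ _ lt zi) (nzaft _ _ _ lt zj).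
  by move: nb; rewrite -bi -aj (nzbef _ _ _ lt zj) (nzaft _ _ _ lt zi).
have clsg b1 b2 r : b1 || b2 -> 0 < count ((cls b1 b2)^~ r) (iota 0 m') -> glob r.
  move=> bb; rewrite -has_count => /hasP[i im /and3P[zi /eqP bi /eqP ai]].
  by apply/hasP; exists i => //; rewrite zi bi ai.
have loc r : 0 < count ((cls false false)^~ r) (iota 0 m') -> ~~ glob r.
  rewrite -has_count => /hasP[i im /and3P[zi /eqP bi /eqP ai]].
  apply/negP => /hasP[j jm /andP[zj baj]].
  case: (ltngtP i j) => lt.
  - by move: ai; rewrite (nzaft _ _ _ lt zj).
  - by move: bi; rewrite (nzbef _ _ _ lt zj).
  - by move: baj; rewrite -lt bi ai.
set n0 := size X0.
have sX0 : n0 = \sum_(r <- X) glob r by rewrite /n0 size_filter count_sum.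
have sF1 b1 b2 : ~~ (b1 && b2) -> b1 || b2 -> \sum_(i <- iota 0 m') size (F b1 b2 i) <= n0.
  move=> nb bb; rewrite sum_size_filter sX0; apply: leq_sum => r _.
  have := cls1 b1 b2 r nb; have := clsg b1 b2 r bb.
  by case: (count _ _) => // -[|//] ->.
have sF0 : \sum_(i <- iota 0 m') size (F false false i) + n0 <= size X.
  rewrite sum_size_filter sX0 -big_split /= -[size X]muln1 -sum_const_seq.
  apply: leq_sum => r _; have := cls1 false false r isT; have := loc r.
  by case: (count _ _) => [|[|//]] h _; [case: (glob r)|rewrite (negbTE (h isT))].
(* A pair of a row and one of its middle slabs is a 1 of the merged matrix, which also avoids
   [W]. *)
have sF2 : \sum_(i <- iota 0 m') size (F true true i) <= x1 * n0 + y1 * m'.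
  apply: leq_trans (_ : _ <= ones_in (merge_cols A cut) X0 0 (0 + m')) _; last first.
    apply: bW1 => //; first exact: filter_uniq.
    move=> [r [h1 h2 h3]]; apply: nocc; exists r; split=> //.
      by move=> i /h2; rewrite mem_filter => /andP[].
    by rewrite -cutm -cut0; apply: embeds_merge.
  rewrite sum_size_filter ones_in_filter /index_iota add0n subn0; apply: leq_sum => r _.
  have := clsg true true r isT; case: (glob r).
    by move=> _; rewrite mul1n; apply: sub_count => i /and3P[].
  by case: (count _ _) => // c /(_ isT).
pose grp r := rank X0 r %/ s.
pose gamma := (n0 %/ s).+1.
have hg : {homo grp : i j / i <= j} by move=> i j ij; apply: leq_div2r; exact: rank_homo.
have nh : ~ occurs k.*2 (hats sigma k) A X0 (cut 0) (cut m').
  rewrite cut0 cutm => -[r [h1 h2 h3]]; apply: nocc; exists r; split=> //.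
    by move=> i /h2; rewrite mem_filter => /andP[].
  by move: h3; rewrite eW => /embeds_catr /embeds_catl.
have FX0 i : i < m' -> {subset F true true i <= X0}.
  move=> im r; rewrite !mem_filter => /andP[h ->]; rewrite andbT.
  apply: (clsg true true) => //; rewrite -has_count; apply/hasP; exists i => //.
  by rewrite mem_iota.
have [|g|r rX0||H [hH sH oH]] := @middle_bound k sigma tau A X0 grp cut gamma s s m'
    (fun i => if i < m' then F true true i else [::]) k0 tauP sigP hg hc _ _ _ _ nh.
- by move=> i; case: ifP => // /FX0.
- by apply: rank_group => //; exact: filter_uniq.
- by rewrite /grp ltnS leq_div2r // ltnW // rank_ltn.
- by move=> i _; exact: cutw.
rewrite -cutm -{1}cut0 ones_in_cuts //.
have e11 (f : nat -> seq nat -> nat) :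
    \sum_(i <- iota 0 m') f i (if i < m' then F true true i else [::]) =
    \sum_(i <- iota 0 m') f i (F true true i).
  by rewrite big_seq [RHS]big_seq; apply: eq_bigr => i; rewrite mem_iota add0n => /andP[_ ->].
rewrite (e11 (fun i S => ones_in A S (cut i) (cut i.+1))) (e11 (fun _ S => size S)) -/C in oH.
rewrite -/C in sH.
under eq_bigr do rewrite split4.
rewrite !big_split /=.
have t00 : \sum_(i <- iota 0 m') ones_in A (F false false i) (cut i) (cut i.+1) <=
    x * (\sum_(i <- iota 0 m') size (F false false i)) + y * m.
  apply: sumB => i im; rewrite {1}cutS; apply: bW => //; rewrite -cutS => h; apply: nocc.
  by apply: occurs_sub h.
have t01 : \sum_(i <- iota 0 m') ones_in A (F false true i) (cut i) (cut i.+1) <=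
    x2 * (\sum_(i <- iota 0 m') size (F false true i)) + y2 * m.
  apply: sumB => i im; rewrite {1}cutS; apply: bWl => //; rewrite -cutS => h; apply: nocc.
  have := occurs_rcons (hc _ _ (leqnSn i)) (cm i.+1) qK (@Fa false i) h.
  exact: occurs_sub.
have t10 : \sum_(i <- iota 0 m') ones_in A (F true false i) (cut i) (cut i.+1) <=
    x2 * (\sum_(i <- iota 0 m') size (F true false i)) + y2 * m.
  apply: sumB => i im; rewrite {1}cutS; apply: bWr => //; rewrite -cutS => h; apply: nocc.
  have := occurs_cons (ca i) (hc _ _ (leqnSn i)) pK (@Fb false i) h.
  exact: occurs_sub.
have tH : \sum_(i <- iota 0 m') ones_in A (H i) (cut i) (cut i.+1) <=
    x3 * (\sum_(i <- iota 0 m') size (H i)) + y3 * m.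
  apply: sumB => i im; have [uH HF] := hH i; rewrite im in HF.
  rewrite {1}cutS; apply: bV => //; rewrite -cutS => h; apply: nocc.
  have hV := occurs_rcons (hc _ _ (leqnSn i)) (cm i.+1) qK (fun r rH => Fa true i r (HF r rH)) h.
  have := occurs_cons (ca i) (leq_trans (hc _ _ (leqnSn i)) (cm i.+1)) pK
    (fun r rH => Fb true i r (HF r rH)) hV.
  by apply: occurs_sub => // r /HF/FX.
(* In [sg] the 4 comes from two rounded-up groups, costing [2 * s <= 2 * m], and from
   [s * m' <= 2 * m]. *)
have s01 := sF1 false true isT isT; have s10 := sF1 true false isT isT.
have sg : s * (gamma.+1 + m') <= n0 + 4 * m.
  have := leq_divM n0 s; rewrite /gamma !mulnDr !mulnS; lia.
clear - t00 t01 t10 tH s01 s10 sg sF0 sF2 sH oH hx yY m's sm.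
move: (\sum_(_ <- _) ones_in _ (F false false _) _ _) (\sum_(_ <- _) ones_in _ (F false true _) _ _)
  (\sum_(_ <- _) ones_in _ (F true false _) _ _) (\sum_(_ <- _) ones_in _ (F true true _) _ _)
  (\sum_(_ <- _) ones_in _ (H _) _ _) t00 t01 t10 tH oH => o00 o01 o10 o11 oh.
move: (\sum_(_ <- _) size (F false false _)) (\sum_(_ <- _) size (F false true _))
  (\sum_(_ <- _) size (F true false _)) (\sum_(_ <- _) size (F true true _))
  (\sum_(_ <- _) size (H _)) s01 s10 sF0 sF2 sH => n00 n01 n10 n11 nh s01 s10 sF0 sF2 sH t00 t01 t10 tH oH.
move: (gamma.+1 + m') sg sH oH => gm sg sH oH; clearbody n0.
clear - s01 s10 sF0 sF2 sH t00 t01 t10 oH hx yY m's sm sg tH.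
set n := size X in sF0 *; clearbody n; clearbody m' C.
have h1 : C * (s * gm) <= C * (n0 + 4 * m) by rewrite leq_mul2l sg orbT.
have h2 : x3 * nh <= x3 * (C * (n0 + 4 * m)).
  rewrite leq_mul2l; apply/orP; right; apply: leq_trans sH _; lia.
have h3 : y1 * m' <= Y * (2 * m).
  apply: leq_trans (_ : _ <= Y * s * m') _; first by rewrite leq_mul2r yY orbT.
  by rewrite -mulnA leq_mul2l; apply/orP; right; lia.
have h4 : x2 * n01 <= x2 * n0 by rewrite leq_mul2l s01 orbT.
have h5 : x2 * n10 <= x2 * n0 by rewrite leq_mul2l s10 orbT.
have h6 : x * (n00 + n0) <= x * n by rewrite leq_mul2l sF0 orbT.
have h7 : (2 * x1 + 2 * x2 + C * (1 + x3)) * n0 <= x * n0 by rewrite leq_mul2r hx orbT.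
rewrite !mulnDr !mulnDl in oH h1 h2 h6 h7 *; lia.
Qed.

(** * Base cases of the recursion *)

Lemma ones_in_le A X a m : ones_in A X a (a + m) <= size X * m.
Proof.
rewrite -sum_const_seq; apply: leq_sum => r _.
by apply: leq_trans (count_size _ _) _; rewrite size_iota addKn.
Qed.

Lemma light_bound_trivial K W M : light_bound K W M 0 M.
Proof.
move=> A X a m _ mM _; rewrite mul0n addn0 mulnC.
by apply: leq_trans (ones_in_le _ _ _ _) _; rewrite leq_mul2l mM orbT.
Qed.

Lemma sort_nth_ltn (X : seq nat) i j : uniq X -> i < j -> j < size X ->
  nth 0 (sort leq X) i < nth 0 (sort leq X) j.
Proof.
move=> uX ij jX; apply: (sorted_ltn_nth ltn_trans 0 _ i j) => //; rewrite ?inE ?size_sort //.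
  by rewrite ltn_sorted_uniq_leq sort_uniq uX sort_sorted //; exact: leq_total.
exact: ltn_trans jX.
Qed.

Lemma sort_nth_mem (X : seq nat) i : i < size X -> nth 0 (sort leq X) i \in X.
Proof. by move=> iX; rewrite -(mem_sort leq) mem_nth ?size_sort. Qed.

(** The empty list still demands [K] rows, so avoiding it limits the size of [X]. *)
Lemma light_bound_nil K M : light_bound K [::] 0 K M.
Proof.
move=> A X a m uX _ nocc; rewrite mul0n add0n.
apply: leq_trans (ones_in_le _ _ _ _) _; rewrite leq_mul2r; apply/orP; right.
rewrite leqNgt; apply/negP => KX; apply: nocc.
exists (nth 0 (sort leq X)); split=> // [i j ij jK|i iK].
  by apply: sort_nth_ltn => //; exact: ltn_trans KX.
by apply: sort_nth_mem; exact: ltn_trans KX.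
Qed.

(** A 1 in a row with at least [p] rows of [X] above it and [K - p - 1] below it would be an
    occurrence. All but at most [K] rows are of this kind, hence empty. *)
Lemma light_bound_single K p M : p < K -> light_bound K [:: p] 0 K M.
Proof.
move=> pK A X a m uX _ nocc; rewrite mul0n add0n.
pose s := sort leq X; pose n := size X.
have ss : size s = n by rewrite size_sort.
have -> : ones_in A X a (a + m) = ones_in A s a (a + m).
  by apply: perm_big; rewrite perm_sym perm_sort.
rewrite -(cat_take_drop p s) -(cat_take_drop (n - K) (drop p s)) !ones_in_cat.
have h1 := ones_in_le A (take p s) a m.
have h3 := ones_in_le A (drop (n - K) (drop p s)) a m.
have h2 : ones_in A (take (n - K) (drop p s)) a (a + m) = 0.
  apply/eqP; rewrite /ones_in sum_nat_seq_eq0; apply/allP => r /(nthP 0)[i].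
  rewrite size_take size_drop ss => il <-; apply/implyP => _.
  have iK : i < n - K by move: il; case: ifP; lia.
  rewrite nth_take // nth_drop eqn0Ngt -has_count; apply/negP => /hasP[c].
  rewrite mem_index_iota => /andP[c1 c2] Ac; apply: nocc.
  exists (fun t => nth 0 s (t + i)); split=> [t u tu uK|t tK|].
  - by apply: sort_nth_ltn => //; rewrite -/n; lia.
  - by apply: sort_nth_mem; rewrite -/n; lia.
  - by exists c.
rewrite h2; apply: leq_trans (leq_add h1 h3) _.
rewrite -mulnDl leq_mul2r size_take !size_drop ss; apply/orP; right.
case: ifP; lia.
Qed.

(* ack, with an extra level 0 that serves as the base of the recursion. *)
Fixpoint hier (i j : nat) : nat :=
  if i is i'.+1 then iter j.-1 (fun w => w * hier i' w) 2 else 2.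

Lemma hier_gt0 i j : 0 < hier i j.
Proof.
elim: i j => //= i IH j; elim: j.-1 => //= u IHu.
by rewrite muln_gt0 IHu IH.
Qed.

Lemma hier_ack i j : 0 < i -> 0 < j -> hier i j = ack i j.
Proof.
case: i => // i _; elim: i j => [|i IH] [//|j] _.
  by rewrite ack1 /=; elim: j => //= j ->; rewrite [in RHS]expnS mulnC.
change (iter j (fun w => w * hier i.+1 w) 2 = iter j (fun w => w * ack i.+1 w) 2).
elim: j => // j IHj; rewrite !iterS IHj IH //.
by elim: j {IHj} => // j IHj; rewrite iterS muln_gt0 IHj ack_gt0.
Qed.

(** Designed so that [z(l,i)] dominates [z(l,i-1) + 2 z(l-1,i) + C z(l-2,i)] for [C <= M]. From
    [l = 3] on it is linear in [i], with increment [3 * Z * (3 * M) ^ (l - 3)] large enough for the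
    last two terms by [z_coef_le]; for [l = 2] these terms vanish. *)
Definition z_coef (Z M l i : nat) : nat :=
  match l with
  | l'.+3 => Z * (3 * M) ^ l' * (3 * i.+1)
  | 2 => Z
  | _ => 0
  end.

(* Truncated subtraction: x_coef is 0 for l <= 1. *)
Definition x_coef (C Z M l i : nat) : nat := 2 ^ i * z_coef Z M l i - C.

(** [4 ^ i] answers the factor 4 put by [light_bound_step] on the merged level, and the growth of
    the factor [i.+1] pays for shorter patterns. The value [K] is that of the base cases. *)
Definition y_coef (K V M l i : nat) : nat :=
  if l is l'.+2 then 4 ^ i * V * (4 * M) ^ l' * i.+1 else K.

Lemma z_coef_le Z M l i : i < M -> z_coef Z M l.+2 i <= Z * (3 * M) ^ l.
Proof.
case: l => [|l] iM /=; first by rewrite muln1.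
by rewrite -mulnA leq_mul2l expnSr leq_mul2l leq_mul2l iM !orbT.
Qed.

(** The shift by [C] absorbs the inhomogeneous term, since [2 * (u - C) + C = 2 * u - C]; the rest
    is the recursion of [z_coef], the doubling being carried by [2 ^ i]. *)
Lemma x_coef_rec C Z M l i : i.+2 <= M -> C <= M -> C <= Z ->
  2 * x_coef C Z M l.+2 i + 2 * x_coef C Z M l.+1 i.+1
    + C * (1 + x_coef C Z M l i.+1) <= x_coef C Z M l.+2 i.+1.
Proof.
move=> iM CM CZ; rewrite /x_coef expnS.
have t0 : 0 < 2 ^ i by rewrite expn_gt0.
have CT : C <= 2 ^ i * Z by apply: leq_trans CZ _; rewrite leq_pmull.
case: l => [|[|l]]; rewrite /z_coef ?expn0 ?muln0 ?sub0n.
- lia.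
- by move: (2 ^ i) t0 CT => t t0 CT; rewrite muln1; nia.
set P := 2 * 2 ^ i * (Z * (3 * M) ^ l).
have h1 : 2 * 2 ^ i * z_coef Z M l.+2 i.+1 <= P by rewrite leq_mul2l z_coef_le ?orbT.
have h2 : C * (1 + (2 * 2 ^ i * z_coef Z M l.+2 i.+1 - C)) <= C + M * P.
  rewrite mulnDr muln1 leq_add2l; apply: leq_mul => //.
  by apply: leq_trans h1; exact: leq_subr.
have CP : C <= P.
  apply: leq_trans CZ _; rewrite /P mulnCA leq_pmulr // muln_gt0 muln_gt0 t0 expn_gt0 /=.
  by apply/orP; left; lia.
have e1 : 2 ^ i * (Z * (3 * M) ^ l.+1 * (3 * i.+1)) * 2 = P * (9 * M * i.+1).
  by rewrite /P expnS; lia.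
have e2 : 2 * 2 ^ i * (Z * (3 * M) ^ l.+1 * (3 * i.+2)) = P * (9 * M * i.+2).
  by rewrite /P expnS; lia.
have e3 : 2 * 2 ^ i * (Z * (3 * M) ^ l * (3 * i.+2)) = P * (3 * i.+2) by rewrite /P; lia.
have h3 : P * (3 * i.+2) <= P * (3 * M) by rewrite !leq_mul2l iM !orbT.
have h4 : P * (9 * M * i.+2) = P * (9 * M * i.+1) + 9 * (M * P) by lia.
move: h2; rewrite /z_coef -/(z_coef Z M l.+2 i.+1) e2 e3 => h2.
have CMP : C <= M * P by apply: leq_trans CP _; rewrite leq_pmull //; lia.
have h5 : P * (3 * M) = 3 * (M * P) by lia.
have Pc : P <= P * (3 * i.+2) by rewrite leq_pmulr.
rewrite h4; rewrite h5 in h3; move: e1 h2 h3 CMP CP Pc.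
move: (2 ^ i * (Z * _ * _)) (C * _) (P * (3 * _)) (P * (9 * _ * _)) (M * P) => u v c a b.
clear - CM; clearbody P; lia.
Qed.

Lemma y_coef_rec C Z K V M l i : i.+2 <= M -> C <= M -> 3 * K + 2 + 4 * C <= V -> Z <= V ->
  2 * y_coef K V M l.+1 i.+1 + y_coef K V M l i.+1 + 2
    + C * 4 * (1 + x_coef C Z M l i.+1) + 4 * y_coef K V M l.+2 i <= y_coef K V M l.+2 i.+1.
Proof.
move=> iM CM hV ZV.
have f0 : 0 < 4 ^ i by rewrite expn_gt0.
case: l => [|[|l]]; rewrite /y_coef /x_coef ?/z_coef ?expn0 ?muln0 ?sub0n ?addn0.
- rewrite expnS; move: (4 ^ i) f0 => f f0; nia.
- rewrite expn1 expnS; move: (4 ^ i) f0 => f f0.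
  have h : 4 * f * V * i.+2 <= 4 * f * V * M by rewrite leq_mul2l iM orbT.
  have h' : V <= 4 * f * V * M by rewrite -mulnA mulnCA leq_pmulr // !muln_gt0 f0; lia.
  lia.
set X := (X in 1 + X).
set P := 4 * 4 ^ i * (4 * M) ^ l.
have P0 : 0 < P by rewrite /P !muln_gt0 f0 expn_gt0 muln_gt0; apply/orP; left; lia.
have hX : X <= P * V.
  rewrite /X; apply: leq_trans (leq_subr _ _) _.
  apply: leq_trans (_ : _ <= 2 ^ i.+1 * (Z * (3 * M) ^ l)) _.
    by rewrite leq_mul2l z_coef_le ?orbT.
  rewrite /P -expnS -mulnA [_ ^ l * V]mulnC; apply: leq_mul; first exact: leq_exp2r.
  by apply: leq_mul => //; case: (l) => // n; rewrite leq_exp2r // leq_mul2r orbT.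
have hCX : C * X <= M * (P * V) by exact: leq_mul.
have e1 : 4 ^ i.+1 * V * (4 * M) ^ l.+2 * i.+2 =
   4 * (4 ^ i * V * (4 * M) ^ l.+2 * i.+1) + 16 * (M * (M * (P * V))).
  by rewrite /P !expnS; lia.
have e2 : 4 ^ i.+1 * V * (4 * M) ^ l.+1 * i.+2 = 4 * (M * (P * V) * i.+2).
  by rewrite /P !expnS; lia.
have e3 : 4 ^ i.+1 * V * (4 * M) ^ l * i.+2 = P * V * i.+2.
  by rewrite /P !expnS; lia.
have h2 : M * (P * V) * i.+2 <= M * (M * (P * V)).
  by rewrite mulnC leq_mul2r iM orbT.
have h3 : P * V * i.+2 <= M * (P * V) by rewrite mulnC leq_mul2r iM orbT.
have h4 : V <= P * V by rewrite leq_pmull.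
have h5 : 2 * (M * (P * V)) <= M * (M * (P * V)) by rewrite leq_mul2r; apply/orP; right; lia.
have h6 : P * V <= M * (P * V) by rewrite leq_pmull //; lia.
rewrite e1 e2 e3; lia.
Qed.

(* Slabs of width w^(3k) with w = hier i (j-1) leave at most (hier (i-1) w)^(3k) slabs, and this
   width absorbs the factor w^l in the column coefficient of the merged matrix. *)
Lemma light_bound_hats k (sigma tau : nat -> nat) Z V M i0 : 0 < k ->
  (forall i, i < k -> tau i < k /\ sigma (tau i) = i) ->
  (forall j, j < k -> sigma j < k /\ tau (sigma j) = j) ->
  2 ^ (3 * k) + 2 ^ (14 * k) <= Z -> Z <= V -> 3 * k.*2 + 2 + 4 * 2 ^ (14 * k) <= V ->
  2 ^ (14 * k) <= M -> i0 < M ->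
  forall l W L R i j, size W = l -> hats sigma k = L ++ W ++ R -> i <= i0 -> 0 < j ->
  light_bound k.*2 W (x_coef (2 ^ (14 * k)) Z M l i)
    (y_coef k.*2 V M l i * j ^ l) (hier i j ^ (3 * k)).
Proof.
move=> k0 tauP sigP; set C := 2 ^ (14 * k); set E := 3 * k => hZ ZV hV CM iM l.
have CZ : C <= Z by lia.
have j0 j l' : 0 < j -> 0 < j ^ l' by move=> ?; rewrite expn_gt0; apply/orP; left.
have ent p : p \in hats sigma k -> p < k.*2.
  move=> /flatten_mapP[u]; rewrite mem_iota => /andP[_ /sigP[su _]].
  rewrite !inE; lia.
elim/ltn_ind: l => -[|[|l]] IHl W L R i j sW eW ii jp.
- move/size0nil: sW => ->; apply: (@light_bound_weaken _ _ 0 k.*2 (hier i j ^ E)) => //.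
    by rewrite muln1.
  exact: light_bound_nil.
- case: W sW eW => [|p [|//]] // _ eW.
  apply: (@light_bound_weaken _ _ 0 k.*2 (hier i j ^ E)) => //.
    by rewrite leq_pmulr // j0.
  by apply/light_bound_single/ent; rewrite eW mem_cat inE eqxx orbT.
(* At level 0, and at [j = 1] of every level, the width is at most [2 ^ E] and the trivial bound
   applies, provided that [x_coef] is at least [2 ^ E]. *)
have x2E i' : i' <= i0 -> 2 ^ E <= x_coef C Z M l.+2 i'.
  move=> i'0; rewrite /x_coef; apply: leq_trans (_ : Z - C <= _); first by lia.
  apply: leq_sub2r; apply: leq_trans (_ : z_coef Z M l.+2 i' <= _); last first.
    by rewrite leq_pmull // expn_gt0.
  case: (l) => //= l'; rewrite -mulnA leq_pmulr // muln_gt0 expn_gt0 /=.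
  by apply/orP; left; lia.
elim: i ii j jp => [|i IHi] ii j jp.
  apply: (@light_bound_weaken _ _ (2 ^ E) 0 (2 ^ E)) => //; first exact: x2E.
  exact: light_bound_trivial.
case: j jp => // j _; elim: j => [|j IHj].
  apply: (@light_bound_weaken _ _ (2 ^ E) 0 (2 ^ E)) => //; first exact: x2E.
  exact: light_bound_trivial.
set w := hier i.+1 j.+1 in IHj.
have w0 : 0 < w by exact: hier_gt0.
have -> : hier i.+1 j.+2 = w * hier i w by [].
rewrite expnMn.
case: W sW eW IHi IHj => // p W sW eW IHi IHj.
have [V' [q eV]] : exists V' q, W = rcons V' q.
  by case/lastP: W sW {eW IHi IHj} => // V' q _; exists V', q.
rewrite {W}eV in sW eW IHi IHj *.
have sV : size V' = l by move: sW; rewrite /= size_rcons => -[].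
have lE : l.+2 <= E by rewrite /E -(size_hats sigma) eW !size_cat -sW; lia.
have pK : p < k.*2 by apply: ent; rewrite eW mem_cat inE eqxx orbT.
have qK : q < k.*2 by apply: ent; rewrite eW mem_cat mem_cat inE mem_rcons inE eqxx !orbT.
have bl := IHl l.+1 (leqnn _) (p :: V') L (q :: R) i.+1 j.+1.
have br := IHl l.+1 (leqnn _) (rcons V' q) (rcons L p) R i.+1 j.+1.
have bm := IHl l (leqnSn _) V' (rcons L p) (q :: R) i.+1 j.+1.
apply: light_bound_weaken (light_bound_step k0 tauP sigP eW pK qK _ IHj
  (IHi (ltnW ii) w w0) (bl _ _ ii isT) (br _ _ ii isT) (bm _ _ ii isT) (Y := y_coef k.*2 V M l.+2 i) _ _).
all: rewrite -/C.
- by [].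
- have iM2 : i.+2 <= M by lia.
  have := y_coef_rec l iM2 CM hV ZV; set D := (X in X <= _) => hD.
  (* This is why [y] carries a power of [j]: each step in [j] frees [j.+1 ^ l.+1] copies of
     [y_coef], which pay for everything added to the old [y]. *)
  have e1 : j.+2 ^ l.+2 >= j.+1 ^ l.+2 + j.+1 ^ l.+1.
    rewrite !(expnS _ l.+1) -mulSnr; apply: leq_mul => //; by rewrite leq_exp2r.
  have := leq_mul (leqnn (y_coef k.*2 V M l.+2 i.+1)) e1; rewrite mulnDr.
  apply: leq_trans; rewrite -!addnA leq_add2l.
  apply: leq_trans (_ : _ <= D * j.+1 ^ l.+1) _; last by rewrite leq_mul2r hD orbT.
  rewrite /D; clear.
  have := leq_mul (leqnn (y_coef k.*2 V M l i.+1)) (leq_pexp2l (ltn0Sn j) (leqnSn l)).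
  have := j; have : 0 < j.+1 ^ l.+1 by rewrite expn_gt0.
  move: (j.+1 ^ l) (j.+1 ^ l.+1) => u v v0 _ h.
  have h2 d : d <= d * v by rewrite leq_pmulr.
  have := h2 2; have := h2 (C * 4 * (1 + x_coef C Z M l i.+1)); have := h2 (4 * y_coef k.*2 V M l.+2 i).
  rewrite !(mulnDl _ _ v); lia.
- by [].
- by rewrite expn_gt0 w0.
- by rewrite /= sV.
- by rewrite eW /= -cats1 -catA.
- by rewrite size_rcons sV.
- by rewrite eW cat_rcons.
- by rewrite sV.
- by rewrite eW cat_rcons /= -cats1 -catA.
- by rewrite leq_mul2l leq_pexp2l // ?orbT.
apply: x_coef_rec => //; lia.
Qed.

(** Slabs have width [U] with [x <= U] and [y <= U * U], so the merged matrix has about [n / U]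
    columns and its term in [y] costs only [O(n * U)]. Groups are single rows here, and the closing
    rows are bounded trivially by [U] ones each. *)
Lemma hats_bound k (sigma tau : nat -> nat) A n i : 0 < k ->
  (forall i, i < k -> tau i < k /\ sigma (tau i) = i) ->
  (forall j, j < k -> sigma j < k /\ tau (sigma j) = j) ->
  n <= hier i 3 ->
  ~ occurs k.*2 (hats sigma k) A (iota 0 n) 0 n ->
  ones_in A (iota 0 n) 0 n <=
  n * (2 ^ i * (2 ^ (39 * k) * maxn (2 ^ (14 * k)) i.+1 ^ (3 * k - 2))).
Proof.
move=> k0 tauP sigP ni nocc.
set C := 2 ^ (14 * k); set M := maxn C i.+1; set e := 3 * k - 2.
have CM : C <= M by exact: leq_maxl.
have iM : i < M by exact: leq_maxr.
have C0 : 0 < C by rewrite expn_gt0.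
have M0 : 0 < M by exact: leq_trans CM.
(* [21 = 15 + 6]: [2 ^ (15 * k)] is [Z], and [2 ^ (6 * k)] exceeds the power of 3 in [z_coef]. *)
set U := 2 ^ i * (2 ^ (21 * k) * M ^ e).
have U0 : 0 < U by rewrite !muln_gt0 !expn_gt0 M0.
have e2 : 3 * k = e.+2 by rewrite /e; lia.
have p2 a b : a <= b -> 2 ^ a <= 2 ^ b by rewrite leq_exp2l.
have k2 : 2 <= 2 ^ k by rewrite -[X in X <= _]/(2 ^ 1) p2.
have hZ : 2 ^ (3 * k) + C <= 2 ^ (15 * k).
  have -> : 2 ^ (15 * k) = 2 ^ k * C by rewrite -expnD; congr (2 ^ _); lia.
  apply: leq_trans (_ : 2 * C <= _); last by rewrite leq_mul2r k2 orbT.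
  by rewrite mul2n -addnn leq_add2r; apply: p2; lia.
have hV : 3 * k.*2 + 2 + 4 * C <= 2 ^ (20 * k).
  have -> : 2 ^ (20 * k) = 2 ^ (6 * k) * C by rewrite -expnD; congr (2 ^ _); lia.
  have h64 : 64 <= 2 ^ (6 * k) by rewrite -[64]/(2 ^ 6) p2; lia.
  have hk : k < C by apply: leq_trans (ltn_expl k (isT : 1 < 2)) _; apply: p2; lia.
  have := leq_mul h64 (leqnn C); lia.
have ZV : 2 ^ (15 * k) <= 2 ^ (20 * k) by apply: p2; lia.
have lb := @light_bound_hats k sigma tau (2 ^ (15 * k)) (2 ^ (20 * k)) M i k0 tauP sigP
  hZ ZV hV CM iM (3 * k) (hats sigma k) [::] [::] i 3 (size_hats _ _) _ (leqnn i) isT.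
have {lb}/lb : hats sigma k = [::] ++ hats sigma k ++ [::] by rewrite cats0.
set x := x_coef _ _ _ _ _; set y := _ * 3 ^ (3 * k) => lb.
have xU : x <= U.
  rewrite /x /x_coef e2; apply: leq_trans (leq_subr _ _) _.
  apply: leq_trans (_ : _ <= 2 ^ i * (2 ^ (15 * k) * (3 * M) ^ e)) _.
    by rewrite leq_mul2l z_coef_le ?orbT.
  rewrite /U leq_mul2l expnMn mulnA leq_mul2r; apply/orP; right; apply/orP; right.
  have -> : 2 ^ (21 * k) = 2 ^ (15 * k) * 2 ^ (6 * k) by rewrite -expnD; congr (2 ^ _); lia.
  rewrite leq_mul2l; apply/orP; right; apply: leq_trans (_ : 4 ^ e <= _); first by rewrite leq_exp2r // /e; lia.
  by rewrite -(expnM 2 2); apply: p2; rewrite /e; lia.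
have yU : y <= U * U.
  rewrite /y e2 /y_coef.
  have h3 : 3 ^ e.+2 <= 2 ^ (6 * k).
    apply: leq_trans (_ : 4 ^ e.+2 <= _); first by rewrite leq_exp2r.
    by rewrite -(expnM 2 2); apply: p2; rewrite /e; lia.
  have h4 : (4 * M) ^ e * i.+1 <= 2 ^ (6 * k) * (M ^ e * M ^ e).
    rewrite expnMn -mulnA; apply: leq_mul.
      by rewrite -(expnM 2 2); apply: p2; rewrite /e; lia.
    rewrite leq_mul2l; apply/orP; right; apply: leq_trans iM _.
    by rewrite -{1}(expn1 M) leq_pexp2l // /e; lia.
  rewrite -[_ * i.+1]mulnA.
  apply: leq_trans (leq_mul (leq_mul (leqnn (4 ^ i * 2 ^ (20 * k))) h4) h3) _.
  apply: leq_trans (_ : _ <= 4 ^ i * (2 ^ (20 * k) * 2 ^ (6 * k) * 2 ^ (6 * k)) * (M ^ e * M ^ e)) _.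
    by apply: eq_leq; lia.
  have -> : U * U = 4 ^ i * (2 ^ (21 * k) * 2 ^ (21 * k)) * (M ^ e * M ^ e).
    have -> : 4 ^ i = 2 ^ i * 2 ^ i by rewrite -expnMn.
    by rewrite /U; lia.
  by rewrite leq_mul2r leq_mul2l -!expnD p2 ?orbT //; lia.
have goalU : n * (14 * C * U) <= n * (2 ^ i * (2 ^ (39 * k) * M ^ e)).
  rewrite leq_mul2l; apply/orP; right.
  (* [39 = 4 + 14 + 21], for the constant 14, for [C] and for the factor in [U]. *)
  have -> : 2 ^ (39 * k) = 2 ^ (4 * k) * C * 2 ^ (21 * k).
    by rewrite -!expnD; congr (2 ^ _); lia.
  have h14 : 14 <= 2 ^ (4 * k) by apply: (@leq_trans (2 ^ 4)) => //; apply: p2; lia.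
  have := leq_mul h14 (leqnn (C * U)); rewrite /U; lia.
apply: leq_trans goalU; have [nU|Un] := leqP n U.
  apply: leq_trans (ones_in_le A (iota 0 n) 0 n) _; rewrite size_iota leq_mul2l.
  by apply/orP; right; apply: leq_trans nU _; rewrite leq_pmull // muln_gt0.
pose m := (n + U.-1) %/ U.
have mU : n <= m * U <= 2 * n.
  have := leq_divM (n + U.-1) U; have := ltn_ceil (n + U.-1) U0; rewrite -/m; lia.
have mn : m <= n by rewrite -ltnS ltn_divLR //; nia.
pose cut q := minn (q * U) n.
have cut0 : cut 0 = 0 by rewrite /cut mul0n min0n.
have cutm : cut m = n by rewrite /cut (minn_idPr _) //; case/andP: mU.
have hc : {homo cut : i j / i <= j}.
  by move=> a b ab; have : a * U <= b * U by [rewrite leq_mul2r ab orbT]; rewrite /cut; lia.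
have cutS q : cut q.+1 = cut q + (cut q.+1 - cut q) by rewrite subnKC // hc.
have cutw q : cut q.+1 - cut q <= U by rewrite /cut mulSn; lia.
pose F q := [seq r <- iota 0 n | merge_cols A cut r q].
have nocc' : ~ occurs k.*2 (hats sigma k) A (iota 0 n) (cut 0) (cut m) by rewrite cut0 cutm.
have [|q|g|r|q _|H [hH sH oH]] := @middle_bound k sigma tau A (iota 0 n) id cut n 1 U m F k0
  tauP sigP _ hc _ _ _ _ nocc'.
- by [].
- by split; [apply/filter_uniq/iota_uniq|move=> r; rewrite mem_filter => /andP[]].
- by rewrite (eq_count (a2 := pred1 g)) // count_uniq_mem ?iota_uniq //; case: (g \in _).
- by rewrite mem_iota.
- exact: cutw.
have eF : \sum_(q <- iota 0 m) size (F q) = ones_in (merge_cols A cut) (iota 0 n) 0 (0 + m).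
  by rewrite (sum_size_filter (fun q r => merge_cols A cut r q)) /ones_in /index_iota add0n subn0.
have hF : \sum_(q <- iota 0 m) size (F q) <= x * n + y * m.
  rewrite eF -[n in x * n](size_iota 0); apply: lb; first exact: iota_uniq.
    apply: leq_trans mn _; apply: leq_trans ni _; rewrite -[X in X <= _]expn1.
    by rewrite leq_pexp2l ?hier_gt0 //; lia.
  move=> [r [h1 h2 h3]]; apply: nocc'; exists r; split=> //.
  exact: embeds_merge h3.
have hH' : \sum_(q <- iota 0 m) ones_in A (H q) (cut q) (cut q.+1) <=
    (\sum_(q <- iota 0 m) size (H q)) * U.
  rewrite big_distrl; apply: leq_sum => q _; rewrite cutS.
  by apply: leq_trans (ones_in_le _ _ _ _) _; rewrite leq_mul2l cutw orbT.
have -> : ones_in A (iota 0 n) 0 n = \sum_(q <- iota 0 m) ones_in A (F q) (cut q) (cut q.+1).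
  rewrite -{2}cut0 -{2}cutm ones_in_cuts //; apply: eq_bigr => q _.
  rewrite ones_in_filter; apply: eq_bigr => r _.
  by rewrite /merge_cols has_count; case: (count _ _) => // c; rewrite mul1n.
rewrite -/C in sH oH; rewrite mul1n in sH.
clear - sH oH hF hH' xU yU mU mn Un U0 C0.
move: (\sum_(_ <- _) size (F _)) (\sum_(_ <- _) size (H _)) (\sum_(_ <- _) ones_in _ (F _) _ _)
 (\sum_(_ <- _) ones_in _ (H _) _ _) sH oH hF hH' => sF s oF oH' sH oH hF hH'.
have h1 : x * n <= U * n by rewrite leq_mul2r xU orbT.
have h2 : y * m <= U * (2 * n).
  apply: leq_trans (_ : _ <= U * U * m) _; first by rewrite leq_mul2r yU orbT.
  by rewrite -mulnA leq_mul2l mulnC; case/andP: mU => _ ->; rewrite orbT.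
have h3 : C * (n.+1 + m) <= C * (3 * n) by rewrite leq_mul2l; apply/orP; right; lia.
have h4 : s * U <= C * (3 * n) * U by rewrite leq_mul2r (leq_trans sH h3) orbT.
have h5 : U * (m + C * (n.+1 + m)) <= U * (n + C * (3 * n)).
  by rewrite leq_mul2l leq_add ?orbT.
have h6 : U * n <= C * (U * n) by rewrite leq_pmull.
clearbody x y C U; lia.
Qed.

(** * Matrices *)

Definition nat_matrix (n m : nat) (A : 'M[bool]_(n, m)) (r c : nat) : bool :=
  if (insub r, insub c) is (Some i, Some j) then A i j else false.

Lemma nat_matrixE n m (A : 'M[bool]_(n, m)) (i : 'I_n) (j : 'I_m) :
  nat_matrix A i j = A i j.
Proof. by rewrite /nat_matrix !valK. Qed.

Lemma ones_nat_matrix n m (A : 'M[bool]_(n, m)) :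
  ones A = ones_in (nat_matrix A) (iota 0 n) 0 m.
Proof.
have <- : index_iota 0 n = iota 0 n by rewrite /index_iota subn0.
rewrite ones_in_sum.
transitivity (\sum_(i < n) \sum_(j < m) (A i j : nat)).
  rewrite pair_bigA /ones -sum1_card big_mkcond /=; apply: eq_bigr => -[i j] _.
  by rewrite inE /=; case: (A i j).
rewrite big_mkord; apply: eq_bigr => i _; rewrite big_mkord; apply: eq_bigr => j _.
by rewrite nat_matrixE.
Qed.

Lemma embeds_cols A r W a b : embeds A r W a b ->
  exists c : nat -> nat, forall j, j < size W ->
    [/\ A (r (nth 0 W j)) (c j), a <= c j < b & forall i, i < j -> c i < c j].
Proof.
elim: W a => [|p W IH] a; first by exists id.
move=> [x [ax xb Ax /IH[c hc]]]; exists (fun j => if j is j'.+1 then c j' else x).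
move=> [|j] /= jW; first by split=> //; rewrite ax.
have [Aj cj hj] := hc j jW; split=> //; first lia.
by case=> [|i] ij; [lia | apply: hj].
Qed.

Lemma nth_hats sigma k a b : a < k -> b < 3 ->
  nth 0 (hats sigma k) (a * 3 + b) = (sigma a).*2 + (b != 1).
Proof.
move=> + b3; elim: k => // k IH; rewrite hatsS nth_cat size_hats ltnS leq_eqVlt.
case: ifP => [lt /orP[/eqP e|/IH //]|ge /orP[/eqP ->|]]; [lia| |lia].
have -> : k * 3 + b - 3 * k = b by lia.
by case: b b3 {ge IH} => [|[|[|]]] //= _; rewrite ?addn1 ?addn0.
Qed.

Lemma contains_perm_hat k (pi : {perm 'I_k}) n (A : 'M[bool]_n) (sigma : nat -> nat) :
  (forall j : 'I_k, sigma j = (pi^-1)%g j) ->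
  occurs k.*2 (hats sigma k) (nat_matrix A) (iota 0 n) 0 n ->
  contains (perm_hat pi) A.
Proof.
move=> hs [r [hr rX /embeds_cols[c]]]; rewrite size_hats => hc.
have rn (i : 'I_(k * 2)) : r i < n.
  by have := rX i; rewrite mem_iota; apply; have := ltn_ord i; lia.
have j3 (j : 'I_(k * 3)) : j < 3 * k by rewrite [3 * k]mulnC.
have cn (j : 'I_(k * 3)) : c j < n by have [_ /andP[_]] := hc j (j3 j).
apply/existsP; exists [ffun i => Ordinal (rn i)].
apply/existsP; exists [ffun j => Ordinal (cn j)].
apply/and3P; split.
- apply/forallP => i; apply/forallP => j; apply/implyP => ij; rewrite !ffunE /=.
  by apply: hr => //; have := ltn_ord j; lia.
- apply/forallP => i; apply/forallP => j; apply/implyP => ij; rewrite !ffunE /=.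
  by have [_ _] := hc j (j3 j); apply.
apply/forallP => i; apply/forallP => j; apply/implyP; rewrite !ffunE.
rewrite /perm_hat -(nat_matrixE A) /=.
have [+ _ _] := hc j (j3 j).
case: (mxtens_indexP i) => i1 i2; case: (mxtens_indexP j) => j1 j2.
rewrite tensmxE /= nth_hats // hs => Ah /andP[+ hat_ij]; move: hat_ij.
rewrite !mxE => hat_ij; case: eqP => [e12 _|//].
move: Ah; have <- : i1 = (pi^-1)%g j1 by rewrite -e12 permK.
(* At the 1s of the hat, the row is 0 exactly in the middle column. *)
have -> : i1.*2 + (j2 != 1 :> nat) = i1 * 2 + i2; last by [].
rewrite muln2; congr (_ + _); move: hat_ij.
by case: i2 j2 => -[|[|//]] ? [[|[|[|//]]] ?].
Qed.

(** For a square matrix the quotient [n / n] is 1, so the column of the Ackermann table is 3. *)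
Lemma alpha_hier n : 0 < n -> 0 < alpha n /\ n <= hier (alpha n) 3.
Proof.
move=> n0; rewrite /alpha /alpha2; case: ex_minnP => i /andP[i0 h] _; split=> //.
rewrite hier_ack //; move: h; rewrite /alpha_col.
have -> : (n + n.-1) %/ n = 1.
  by rewrite -{1}(mul1n n) divnMDl // divn_small ?addn0 // prednK.
by [].
Qed.

Lemma Ex_perm_hat_le k (pi : {perm 'I_k}) n : 0 < k -> 0 < n ->
  Ex (perm_hat pi) n <=
  n * (2 ^ alpha n * (2 ^ (39 * k) * maxn (2 ^ (14 * k)) (alpha n).+1 ^ (3 * k - 2))).
Proof.
move=> k0 n0; apply/bigmax_leqP => A avA; rewrite ones_nat_matrix.
pose ext (f : 'I_k -> 'I_k) (j : nat) : nat := if insub j is Some o then val (f o) else 0.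
have extE f (j : 'I_k) : ext f j = f j by rewrite /ext valK.
have extP f g : cancel f g -> forall i, i < k -> ext f i < k /\ ext g (ext f i) = i.
  by move=> fK i ik; rewrite -[i]/(val (Ordinal ik)) !extE fK.
apply: (@hats_bound k (ext (pi^-1)%g) (ext pi)) => //.
- exact/extP/permK.
- exact/extP/permKV.
- by have [] := alpha_hier n0.
move=> /(contains_perm_hat (extE _)) h; by move: avA; rewrite /avoids h.
Qed.


(** Split on which argument attains the maximum. If it is [2 ^ (14 * k)], its power is at most
    [2 ^ (42 * k ^ 2)], and [81 = 42 + 39]. Otherwise [alpha n + 1 <= 2 * alpha n], and
    [2 ^ (39 * k)] enters the power because [k <= 3 * k - 2]. *)
Lemma Ex_perm_hat_le_sum k (pi : {perm 'I_k}) n : 0 < k -> 0 < n ->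
  Ex (perm_hat pi) n <=
  n * ((2 ^ (81 * k ^ 2) + (2 ^ 40 * alpha n) ^ (3 * k - 2)) * 2 ^ alpha n).
Proof.
move=> k0 n0; apply: leq_trans (Ex_perm_hat_le pi k0 n0) _.
rewrite leq_mul2l; apply/orP; right; rewrite mulnC leq_mul2r; apply/orP; right.
have [a0 _] := alpha_hier n0; set e := 3 * k - 2.
have ke : k <= e <= 3 * k by rewrite /e; lia.
have kk : k <= k ^ 2 by rewrite -mulnn leq_pmulr.
have h : maxn (2 ^ (14 * k)) (alpha n).+1 ^ e <= 2 ^ (42 * k ^ 2) + (2 * alpha n) ^ e.
  have [le|le] := leqP (alpha n).+1 (2 ^ (14 * k)).
    apply: leq_trans (leq_addr _ _).
    rewrite -expnM leq_exp2l // -mulnn; nia.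
  apply: leq_trans (leq_addl _ _).
  by rewrite leq_exp2r; lia.
have key c : (2 ^ c.+1 * alpha n) ^ e = 2 ^ (c * e) * (2 * alpha n) ^ e.
  by rewrite expnS mulnAC expnMn [_ ^ e * _]mulnC -expnM.
apply: leq_trans (leq_mul (leqnn _) h) _; rewrite mulnDr; apply: leq_add.
  by rewrite -expnD leq_exp2l //; lia.
rewrite key leq_mul2r; apply/orP; right.
by rewrite leq_exp2l // leq_mul2l; case/andP: ke => ->; rewrite orbT.
Qed.

(** Any [n] above the finitely many values [hier j 3] with [j < i] cannot have a smaller [alpha]. *)
Lemma alpha_unbounded i : exists N, forall n, N <= n -> i <= alpha n.
Proof.
exists (\sum_(j < i) hier j 3).+1 => n Nn; rewrite leqNgt; apply/negP => ai.
have [_] := @alpha_hier n (leq_ltn_trans (leq0n _) Nn).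
by rewrite leqNgt => /negP; apply; apply: leq_trans Nn; rewrite ltnS (bigD1 (Ordinal ai)) //= leq_addr.
Qed.

(* Real exponents and the asymptotic form *)
From mathcomp Require Import all_classical all_reals all_analysis.
From mathcomp Require Import ring lra.
Import numFieldNormedType.Exports.
Import Order.TTheory GRing.Theory Num.Theory.
Local Open Scope classical_set_scope.
Local Open Scope ring_scope.

Lemma ler_powR2 (R : realType) (q : R) : 0 <= q -> q <= 2 `^ q.
Proof.
move=> q0; have /andP[h1 h2] := truncn_itv q0.
apply: le_trans (ltW h2) _; apply: le_trans (_ : (2 ^ Num.truncn q)%:R <= _).
  by rewrite ler_nat ltn_expl.
by rewrite natrX -powR_mulrn // ler_powR // ler1n.
Qed.

(** Write [a = q ^ 4]. Then [a <= 2 ^ (4q)], so the power is at most [2 ^ (120k + 12qk)], and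
    [2qk <= k ^ 2 + q ^ 2] separates [k] from [q ^ 2], the square root of [a]. Adding two terms
    below the same bound raises 126 to 127. *)
Lemma powR_sqrt_bound (R : realType) (c k a : nat) : (c <= 40)%N -> (1 <= k)%N -> (1 <= a)%N ->
  (2 ^ (81 * k ^ 2) + (2 ^ c * a) ^ (3 * k - 2))%N%:R
  <= 2 `^ (127 * k%:R ^+ 2 + 6 * Num.sqrt a%:R) :> R.
Proof.
move=> c40 k1 a1.
have R2 : (1 : R) <= 2 by rewrite ler1n.
set s := Num.sqrt (a%:R : R); pose q := Num.sqrt s.
have s0 : 0 <= s by exact: sqrtr_ge0.
have q0 : 0 <= q by exact: sqrtr_ge0.
have sE : s = q ^+ 2 by rewrite sqr_sqrtr.
have aE : a%:R = q ^+ 4 by rewrite (exprM q 2 2) -sE sqr_sqrtr.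
have k1R : (1 : R) <= k%:R by rewrite ler1n.
have ha : (a%:R : R) <= 2 `^ (4 * q).
  rewrite aE mulrC powRrM powR_mulrn ?powR_ge0 //.
  by rewrite lerXn2r ?nnegrE ?powR_ge0 // ler_powR2.
have h1 : ((2 ^ (81 * k ^ 2))%N%:R : R) <= 2 `^ (126 * k%:R ^+ 2 + 6 * s).
  rewrite natrX -powR_mulrn // ler_powR // natrM natrX; nra.
have h2 : (((2 ^ c * a) ^ (3 * k - 2))%N%:R : R) <= 2 `^ (126 * k%:R ^+ 2 + 6 * s).
  have b1 : (1 : R) <= (2 ^ c * a)%N%:R by rewrite ler1n muln_gt0 expn_gt0.
  rewrite natrX; apply: le_trans (_ : (2 ^ c * a)%N%:R ^+ (3 * k) <= _).
    by apply: ler_weXn2l => //; exact: leq_subr.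
  apply: le_trans (_ : (2 `^ (40 + 4 * q)) ^+ (3 * k) <= _).
    rewrite lerXn2r ?nnegrE ?powR_ge0 // natrM powRD; last by apply/implyP; rewrite pnatr_eq0.
    by rewrite natrX -powR_mulrn // ler_pM ?powR_ge0 // ler_powR // (ler_nat _ _ 40).
  rewrite -powR_mulrn ?powR_ge0 // -powRrM ler_powR // natrM sE.
  have := sqr_ge0 (k%:R - q); nra.
rewrite natrD; apply: le_trans (lerD h1 h2) _.
have double x : 2 `^ x + 2 `^ x = 2 `^ (1 + x) :> R.
  by rewrite powRD ?pnatr_eq0 ?implybT // powRr1 // mulr_natl mulr2n.
by rewrite double ler_powR //; nra.
Qed.

Theorem theorem3 (R : realType) :
  (exists K : R, 0 < K /\
     forall (k : nat) (pi : {perm 'I_k}) (n : nat),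
       (1 <= k)%N -> (1 <= n)%N ->
       (Ex (perm_hat pi) n)%:R <=
         n%:R * (2 `^ (K * k%:R ^+ 2)
                 + (K * (alpha n)%:R) ^+ (3 * k - 2)%N) * 2 ^+ alpha n)
  /\
  (exists (C : R) (eps : nat -> R),
     0 < C /\ (eps n @[n --> \oo] --> (0 : R)) /\
     forall (k : nat) (pi : {perm 'I_k}) (n : nat),
       (1 <= k)%N -> (1 <= n)%N ->
       (Ex (perm_hat pi) n)%:R <=
         n%:R * 2 `^ (C * k%:R ^+ 2 + (1 + eps n) * (alpha n)%:R)).
Proof.
have R2 : (1 : R) <= 2 by rewrite ler1n.
split.
  (* [2 ^+ 40] is the factor in front of [alpha n]; as an exponent constant it only has to exceed
     81. *)
  exists (2 ^+ 40); split=> [|k pi n k1 n1]; first exact: exprn_gt0.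
  have := Ex_perm_hat_le_sum pi k1 n1; rewrite -(ler_nat R) => /le_trans; apply.
  have castE c e : ((2 ^ c * alpha n) ^ e)%N%:R = (2 ^+ c * (alpha n)%:R) ^+ e :> R.
    by rewrite natrX natrM natrX.
  rewrite natrM [X in _ * X]natrM natrD castE [(2 ^ alpha n)%N%:R]natrX mulrA.
  rewrite ler_wpM2r ?exprn_ge0 // ler_wpM2l // lerD2r.
  rewrite natrX -[2 ^+ (81 * _)]powR_mulrn // ler_powR // natrM natrX ler_wpM2r ?exprn_ge0 //.
  apply: le_trans (_ : 2 ^+ 7 <= _); last by rewrite ler_weXn2l.
  by rewrite -natrX ler_nat.
(* With this [eps], [eps n * alpha n] is 6 times the square root of [alpha n], the error in
   [powR_sqrt_bound]. *)
exists 127, (fun n => 6 / Num.sqrt (alpha n)%:R); split=> //; split.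
  apply/cvgrPdist_lt => e e0.
  have [i hi] : exists i : nat, (6 / e) ^+ 2 < i%:R.
    by exists (Num.truncn ((6 / e) ^+ 2)).+1; exact: truncnS_gt.
  have [N hN] := alpha_unbounded i.
  exists N => // n /= /hN; rewrite -(ler_nat R) => /(lt_le_trans hi) ia.
  have e60 : 0 < 6 / e by rewrite divr_gt0.
  have hs : 6 / e < Num.sqrt (alpha n)%:R.
    by rewrite -(ltr_pXn2r (n := 2)) ?nnegrE ?sqrtr_ge0 ?(ltW e60) // sqr_sqrtr.
  have s0 := lt_trans e60 hs.
  rewrite sub0r normrN ger0_norm ?divr_ge0 ?sqrtr_ge0 //.
  by rewrite ltr_pdivrMr // mulrC -ltr_pdivrMr.
move=> k pi n k1 n1.
have [a1 _] := alpha_hier n1.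
have := Ex_perm_hat_le_sum pi k1 n1; rewrite -(ler_nat R) => /le_trans; apply.
rewrite natrM ler_wpM2l // natrM.
have s0 : 0 < Num.sqrt (alpha n)%:R :> R by rewrite sqrtr_gt0 ltr0n.
have -> : 127 * k%:R ^+ 2 + (1 + 6 / Num.sqrt (alpha n)%:R) * (alpha n)%:R =
    127 * k%:R ^+ 2 + 6 * Num.sqrt (alpha n)%:R + (alpha n)%:R :> R.
  rewrite -{2 4}(@sqr_sqrtr R (alpha n)%:R) //; field; exact: lt0r_neq0.
rewrite powRD; last by apply/implyP; rewrite pnatr_eq0.
by rewrite natrX powR_mulrn // ler_wpM2r ?exprn_ge0 // (@powR_sqrt_bound _ 40).
Qed.
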